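(* Let $s\in\mathbb{N}_+$. Let $f\in C^s[0,1]$ with $f(0),f(1)\in\mathbb{Z}$, and suppose that $f^{(s)}$ is absolutely continuous with an essentially bounded derivative in some neighbourhoods (relative to $[0,1]$) of $0$ and $1$. If \[ \|(\widetilde{B}_n(f))^{(s)}-f^{(s)}\|=O(n^{-1})\quad\text{or}\quad \|(\widehat{B}_n(f))^{(s)}-f^{(s)}\|=O(n^{-1})\qquad(n\to\infty), \] then \[ \omega_\varphi^2(f^{(s)},h)=O(h^2)\quad\text{and}\quad\omega_1(f^{(s)},h)=O(h)\qquad(h\to0+); \] hence $f^{(s)}\in AC[0,1]$, $f^{(s+1)}\in AC_{loc}(0,1)$ and $f^{(s+1)},\varphi^2 f^{(s+2)}\in L_\infty[0,1]$.
   Context: $\mathbb{N}_+=\{1,2,\dots\}$; $\|\cdot\|$ is the sup-norm on $[0,1]$; $C^s[0,1]$ is the space of real-valued $s$ times continuously differentiable functions on $[0,1]$. $AC[0,1]$ is the set of absolutely continuous functions on $[0,1]$, and $AC_{loc}(0,1)$ is the set of functions on $(0,1)$ that are absolutely continuous on every compact subinterval of $(0,1)$. For $f\in C[0,1]$, $x\in[0,1]$ and $n\in\mathbb{N}_+$ define \[ \widetilde{B}_n(f)(x):=\sum_{k=0}^n \left[f\left(\tfrac{k}{n}\right)\binom{n}{k}\right]x^k(1-x)^{n-k},\qquad \widehat{B}_n(f)(x):=\sum_{k=0}^n \left\langle f\left(\tfrac{k}{n}\right)\binom{n}{k}\right\rangle x^k(1-x)^{n-k}, \] where $[a]$ is the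 largest integer less than or equal to the real $a$, and $\langle a\rangle$ is the nearest integer to $a$; if $a=m+1/2$ with $m\in\mathbb{Z}$, then $\langle a\rangle$ is set to be either $m$ or $m+1$ (the choice may depend on whether $m$ is positive or negative, even or odd), and the result holds regardless of the choice made. Moduli: with $\varphi(x):=\sqrt{x(1-x)}$, for $F\in C[0,1]$ and $t>0$, \[ \omega_\varphi^2(F,t):=\sup_{0<h\le t}\|\bar\Delta^2_{h\varphi}F\|, \] where $\bar\Delta^2_{h\varphi(x)}F(x):=F(x+h\varphi(x))-2F(x)+F(x-h\varphi(x))$ if $x\pm h\varphi(x)\in[0,1]$ and $:=0$ otherwise; and \[ \omega_1(F,t):=\sup_{|x-y|\le t,\ x,y\in[0,1]}|F(x)-F(y)|. \] The constants implicit in the $O$-symbols may depend on $f$. *)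

(* Defs.v *)
From HB Require Import structures.
From mathcomp Require Export all_boot all_order all_algebra.
From mathcomp Require Export all_classical all_reals all_analysis.
Export Order.TTheory GRing.Theory Num.Theory.
Export numFieldNormedType.Exports.

#[export] Set Implicit Arguments.
#[export] Unset Strict Implicit.
#[export] Unset Printing Implicit Defensive.

Local Open Scope classical_set_scope.
Local Open Scope ring_scope.

(* A function on [0,1] is a total function R -> R of which only the values on
   [0,1] matter. Accordingly, derivatives are taken relative to [0,1]: they are
   two-sided at interior points and one-sided at 0 and 1. *)
Definition diff_quot01 (R : realType) (F : R -> R) (x : R) : set_system R :=
  (fun y => (F y - F x) / (y - x)) @ within `[0, 1] x^'.

Definition derivable01 (R : realType) (F : R -> R) (x : R) : Prop :=
  cvg (diff_quot01 F x).

(* Meaningful only at the x in [0,1] with [derivable01 F x]. *)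
Definition derive01 (R : realType) (F : R -> R) (x : R) : R :=
  lim (diff_quot01 F x).

Definition derive01n (R : realType) (k : nat) (F : R -> R) : R -> R :=
  iter k (@derive01 R) F.

Definition Cs01 (R : realType) (s : nat) (F : R -> R) : Prop :=
  (forall k, (k < s)%N -> forall x : R, x \in `[0, 1] ->
     derivable01 (derive01n k F) x) /\
  {within `[0, 1], continuous (derive01n s F)}.

Definition abs_cont (R : realType) (A : set R) (F : R -> R) : Prop :=
  forall e : R, 0 < e -> exists2 d : R, 0 < d &
    forall (n : nat) (a b : 'I_n -> R),
      (forall i, a i <= b i /\ `[a i, b i] `<=` A) ->
      trivIset setT (fun i => `]a i, b i[%classic) ->
      \sum_(i < n) (b i - a i) < d ->
      \sum_(i < n) `|F (b i) - F (a i)| < e.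

Definition abs_cont_loc01 (R : realType) (F : R -> R) : Prop :=
  forall a b : R, 0 < a -> a <= b -> b < 1 -> abs_cont `[a, b] F.

Definition derivable01_ae (R : realType) (A : set R) (F : R -> R) : Prop :=
  {ae @lebesgue_measure R, forall x, A x -> derivable01 F x}.

(* Membership in L_oo(A) depends only on the class of F modulo equality almost
   everywhere on A. *)
Definition Linfty (R : realType) (A : set R) (F : R -> R) : Prop :=
  exists2 g : R -> R, g \in Lfun (@lebesgue_measure R) +oo%E &
    F = g %[ae @lebesgue_measure R in A].

Definition ess_bounded_deriv (R : realType) (A : set R) (F : R -> R) : Prop :=
  derivable01_ae A F /\ Linfty A (derive01 F).

(* Suprema are taken in the extended reals, so that they are +oo, and not a
   default value, when the set is unbounded. *)
Definition norm01 (R : realType) (F : R -> R) : \bar R :=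
  ereal_sup [set `|F x|%:E | x in `[0, 1]].

(* A tie may be broken either way, differently at different half-integers. *)
Definition nearest_int (R : realType) (rnd : R -> int) : Prop :=
  forall (a : R) (m : int), `|a - (rnd a)%:~R| <= `|a - m%:~R|.

Definition bernstein_rounded (R : realType) (rnd : R -> int) (n : nat)
    (f : R -> R) (x : R) : R :=
  \sum_(k < n.+1)
    (rnd (f (k%:R / n%:R) * 'C(n, k)%:R))%:~R * (x ^+ k * (1 - x) ^+ (n - k)).

Definition bernstein_floor (R : realType) : nat -> (R -> R) -> R -> R :=
  bernstein_rounded (@Num.floor R).

Definition phi (R : realType) (x : R) : R := Num.sqrt (x * (1 - x)).

Definition sym_diff2 (R : realType) (h : R) (F : R -> R) (x : R) : R :=
  if (x + h * phi x \in `[0, 1]) && (x - h * phi x \in `[0, 1])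
  then F (x + h * phi x) - 2 * F x + F (x - h * phi x) else 0.

Definition omega2_phi (R : realType) (F : R -> R) (t : R) : \bar R :=
  ereal_sup [set norm01 (sym_diff2 h F) | h in `]0, t]].

Definition omega1 (R : realType) (F : R -> R) (t : R) : \bar R :=
  ereal_sup [set `|F p.1 - F p.2|%:E | p in
    [set p : R * R | [/\ p.1 \in `[0, 1], p.2 \in `[0, 1] &
                         `|p.1 - p.2| <= t]]].

Definition approx_rate (R : realType) (s : nat) (f : R -> R)
    (B : nat -> (R -> R) -> R -> R) : Prop :=
  exists C : R, \forall n \near \oo,
    (norm01 (fun x => (derive01n s (B n f) x - derive01n s f x)%R)
       <= (C / n%:R)%:E)%E.

(* Main.v *)
(** Write g = f^(s) and let B_n f be the Bernstein polynomial. Since the rounding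
    error is a sum of terms e_k x^k (1 - x)^(n - k) without binomial coefficients,
    its s-th derivative decays exponentially at every fixed x in (0,1). Hence
    n ((B_n f)^(s) - g) stays bounded, up to o(1), at each interior point.

    The map sending f^(s) to (B_n f)^(s) is positive, and by Voronovskaya's theorem
    n ((B_n q)^(s) - q^(s)) tends to (x (1 - x) q'' / 2)^(s) for polynomials q. So if
    a quadratic Q touches g from above at x, comparing g with Q + L (. - x)^4 yields
    x (1 - x) Q'' + s (1 - 2 x) Q' >= - K at x: g solves
    |x (1 - x) g'' + s (1 - 2 x) g'| <= K in the viscosity sense. Comparison with
    quadratic barriers turns this into regularity: g is locally Lipschitz, then
    |g - chord| <= B (u - a) (b - u) on short intervals, so that g is differentiable
    with a locally Lipschitz derivative. The assumption near the endpoints bounds g',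
    and then the chord estimate holds with B of order 1 / (x (1 - x)) uniformly on
    (0,1), which contains all the claims. *)
From HB Require Import structures.
Require Import Defs.
From mathcomp Require Import measurable_realfun ess_sup_inf ring lra zify.
Local Open Scope classical_set_scope.
Local Open Scope ring_scope.

(** * Bernstein polynomials and Voronovskaya's theorem *)

Section bernstein_polynomials.
Context {R : realType}.
Implicit Types (c : nat -> R) (n k s : nat) (p q : {poly R}) (x : R).

(** The coefficients form a sequence instead of samples of a function, so that differentiation acts
    on them through [fdiff]. *)
Definition bern n c : {poly R} :=
  \sum_(k < n.+1) (c k * 'C(n, k)%:R) *: ('X^k * (1 - 'X) ^+ (n - k)).

Definition fdiff c k : R := c k.+1 - c k.

Lemma bernD n c d : bern n (fun k => c k + d k) = bern n c + bern n d.
Proof.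
by rewrite /bern -big_split; apply: eq_bigr => k _ /=; rewrite mulrDl scalerDl.
Qed.

Lemma bernB n c d : bern n (fun k => c k - d k) = bern n c - bern n d.
Proof.
by rewrite /bern -sumrB; apply: eq_bigr => k _; rewrite mulrBl scalerBl.
Qed.

Lemma bernZ n (a : R) c : bern n (fun k => a * c k) = a *: bern n c.
Proof.
by rewrite /bern scaler_sumr; apply: eq_bigr => k _ /=; rewrite -mulrA scalerA.
Qed.

Lemma bern_cst n (a : R) : bern n (fun=> a) = a%:P.
Proof.
have := exprDn (1 - 'X : {poly R}) 'X n.
rewrite subrK expr1n => e.
rewrite -[RHS]mulr1 e mulr_sumr; apply: eq_bigr => k _.
by rewrite -scalerA -mul_polyC scaler_nat [_ * 'X^_]mulrC.
Qed.

Lemma eq_bern n c d : (forall k, (k <= n)%N -> c k = d k) -> bern n c = bern n d.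
Proof. by move=> e; apply: eq_bigr => k _; rewrite e// -ltnS. Qed.

Lemma deriv_onemX_exp m : ((1 - 'X : {poly R}) ^+ m)^`() = - ((1 - 'X) ^+ m.-1 *+ m).
Proof. by rewrite deriv_exp derivB derivX (derivC 1) sub0r mulNr mul1r mulNrn. Qed.

Lemma deriv_XexpM k m : ('X^k * (1 - 'X) ^+ m : {poly R})^`() =
  ('X^(k.-1) * (1 - 'X) ^+ m) *+ k - ('X^k * (1 - 'X) ^+ m.-1) *+ m.
Proof. by rewrite derivM derivXn deriv_onemX_exp mulrnAl mulrN mulrnAr. Qed.

(** The two halves of the product rule meet in the basis of degree n because (k + 1) C(n + 1, k + 1)
    = (n + 1) C(n, k) = (n + 1 - k) C(n + 1, k). *)
Lemma deriv_bern n c : (bern n.+1 c)^`() = n.+1%:R *: bern n (fdiff c).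
Proof.
rewrite /bern /fdiff linear_sum /=.
under eq_bigr do rewrite derivZ deriv_XexpM scalerBr.
rewrite sumrB big_ord_recl [X in _ - X]big_ord_recr /=.
rewrite mulr0n scaler0 add0r subnn mulr0n scaler0 addr0.
rewrite -sumrB scaler_sumr; apply: eq_bigr => k _.
have kn : (k <= n)%N by rewrite -ltnS.
rewrite /bump /= add1n add0n subSS subSn//= -![_ * _ *+ _]scaler_nat !scalerA -scalerBl.
congr (_ *: _).
rewrite -!mulrA -!natrM.
have -> : ('C(n.+1, k.+1) * k.+1 = n.+1 * 'C(n, k))%N by rewrite mulnC -mul_bin_diag.
have -> : ('C(n.+1, k) * (n - k).+1 = n.+1 * 'C(n, k))%N.
  by rewrite mulnC -subSn// -mul_bin_down.
by rewrite -mulrBl natrM; ring.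
Qed.

(** The factor X (1 - X) restores the exponents lowered by differentiation and leaves the multiplier
    k - (k + m) X. *)
Lemma deriv_XexpM_weighted k m (P := 'X^k * (1 - 'X) ^+ m : {poly R}) :
  'X * (1 - 'X) * P^`() = k%:R *: P - (k + m)%:R *: ('X * P).
Proof.
rewrite /P deriv_XexpM !scaler_nat.
have eX j : 'X^(j.-1) *+ j * 'X = 'X^j *+ j :> {poly R}.
  by case: j => [|j]; rewrite ?mulr0n ?mul0r// mulrnAl -exprSr.
have eY j : (1 - 'X) ^+ j.-1 *+ j * (1 - 'X) = (1 - 'X) ^+ j *+ j :> {poly R}.
  by case: j => [|j]; rewrite ?mulr0n ?mul0r// mulrnAl -exprSr.
transitivity ((1 - 'X) * ('X^(k.-1) *+ k * 'X) * (1 - 'X) ^+ m -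
    'X * 'X^k * ((1 - 'X) ^+ m.-1 *+ m * (1 - 'X)) : {poly R}).
  by ring.
by rewrite eX eY; ring.
Qed.

(** By [deriv_XexpM_weighted] with m = n - k, a weight k on the coefficients becomes the operator n
    X + X (1 - X) d/dX. *)
Lemma bern_natM n c : bern n (fun k => k%:R * c k) =
  n%:R *: ('X * bern n c) + 'X * (1 - 'X) * (bern n c)^`().
Proof.
rewrite /bern linear_sum /= !mulr_sumr scaler_sumr -big_split; apply: eq_bigr => k _.
rewrite derivZ -!scalerAr deriv_XexpM_weighted subnKC -1?ltnS//.
rewrite /= scalerBr !scalerA [_ * n%:R]mulrC [RHS]addrC subrK.
by congr (_ *: _); ring.
Qed.

(** By [deriv_bern] the s-th derivative is a positive multiple of the Bernstein polynomial of the
    s-th differences, and the Bernstein basis is nonnegative on [0,1]. *)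
Lemma bern_derivn_ge0 s n c x : (s <= n)%N -> 0 <= x <= 1 ->
  (forall k, (k + s <= n)%N -> 0 <= iter s fdiff c k) -> 0 <= (bern n c)^`(s).[x].
Proof.
elim: s n c => [|s IH] n c sn x01 c0.
  rewrite derivn0 horner_sum; apply: sumr_ge0 => k _.
  rewrite !hornerE /=; have /andP[? ?] := x01.
  by rewrite !mulr_ge0 ?exprn_ge0 ?subr_ge0// c0 ?addn0 -1?ltnS.
case: n sn c0 => // n sn c0; rewrite derivSn deriv_bern derivnZ hornerZ.
apply: mulr_ge0 => //; apply: IH => // k kn.
by rewrite -iterSr; apply: c0; rewrite addnS ltnS.
Qed.

Lemma derivnMX j p : ('X * p)^`(j) = 'X * p^`(j) + p^`(j.-1) *+ j.
Proof.
elim: j => [|j IH]; first by rewrite mulr0n addr0.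
rewrite derivnS IH derivD derivM derivX mul1r derivMn -!derivnS.
case: j {IH} => [|j]; first by rewrite mulr0n addr0 addrC mulr1n.
by rewrite /= [in RHS]mulrS addrA; congr (_ + _); rewrite addrC.
Qed.

(* Convergence of all derivatives at x at once, because the recursion for
   B_n (p X) involves (B_n p)'. *)
Definition pcvg (x : R) (u : nat -> {poly R}) p :=
  forall j, (u n)^`(j).[x] @[n --> \oo] --> p^`(j).[x].

Lemma pcvg_cst x p : pcvg x (fun=> p) p.
Proof. by move=> j; exact: cvg_cst. Qed.

Lemma pcvgD x u v p q : pcvg x u p -> pcvg x v q -> pcvg x (fun n => u n + v n) (p + q).
Proof.
move=> up vq j; rewrite derivnD hornerD.
under eq_fun do rewrite derivnD hornerD.
exact: cvgD.
Qed.

Lemma pcvgZ x (a : R^nat) (l : R) u p : a @ \oo --> l -> pcvg x u p ->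
  pcvg x (fun n => a n *: u n) (l *: p).
Proof.
move=> al up j; rewrite derivnZ hornerZ.
under eq_fun do rewrite derivnZ hornerZ.
exact: cvgM.
Qed.

Lemma pcvg_deriv x u p : pcvg x u p -> pcvg x (fun n => (u n)^`()) p^`().
Proof. by move=> up j; under eq_fun do rewrite -derivSn; rewrite -derivSn; exact: up. Qed.

Lemma pcvgMX x u p : pcvg x u p -> pcvg x (fun n => 'X * u n) ('X * p).
Proof.
move=> up j; rewrite derivnMX hornerD hornerM hornerX hornerMn.
under eq_fun do rewrite derivnMX hornerD hornerM hornerX hornerMn.
by apply: cvgD; [apply: cvgMr|apply: cvgMn].
Qed.

Lemma pcvg_near x u v p : (\forall n \near \oo, u n = v n) -> pcvg x u p -> pcvg x v p.
Proof.
move=> uv up j; apply: cvg_trans (up j); apply: near_eq_cvg.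
by near=> n; congr (_^`(j).[x]); near: n.
Unshelve. all: by end_near. Qed.

Lemma cvg_invn : n%:R^-1 @[n --> \oo] --> (0 : R).
Proof.
apply/gtr0_cvgV0; last exact: cvgr_idn.
by exists 1%N => // n /= n0; rewrite ltr0n.
Qed.

Definition bernp n q : {poly R} := bern n (fun k => q.[k%:R / n%:R]).

(** Sampling X p at k / n puts the weight k / n on the samples of p, which is the situation of
    [bern_natM]. *)
Lemma bernpMXaddC n p (c : R) : (0 < n)%N -> bernp n (p * 'X + c%:P) =
  'X * bernp n p + n%:R^-1 *: ('X * (1 - 'X) * (bernp n p)^`()) + c%:P.
Proof.
move=> n0; have n0' : n%:R != 0 :> R by rewrite pnatr_eq0 -lt0n.
rewrite /bernp; rewrite (_ : (fun k => _) =
    (fun k => n%:R^-1 * (k%:R * p.[k%:R / n%:R]) + c)); last first.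
  by apply/funext => k; rewrite hornerMXaddC; ring.
rewrite bernD bern_cst bernZ bern_natM.
by rewrite scalerDr scalerA mulVf// scale1r.
Qed.

Lemma pcvg_XonemX x u p : pcvg x u p ->
  pcvg x (fun n => 'X * (1 - 'X) * u n) ('X * (1 - 'X) * p).
Proof.
have e r : 'X * (1 - 'X) * r = 'X * r + (-1) *: ('X * ('X * r)) :> {poly R}.
  by rewrite scaleN1r; ring.
move=> up; under eq_fun do rewrite e; rewrite e.
by apply: pcvgD; [exact: pcvgMX|apply: pcvgZ; [exact: cvg_cst|do 2 apply: pcvgMX]].
Qed.

(** Induction on q by Horner's scheme. For q = p X + c, [bernpMXaddC] gives n (B_n q - q) = X n (B_n
    p - p) + X (1 - X) (B_n p)', so the second limit for q needs the first one for p, and both are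
    proved together. *)
Lemma cvg_bernp_voronovskaya x q :
  pcvg x (bernp^~ q) q /\
  pcvg x (fun n => n%:R *: (bernp n q - q)) (2^-1 *: ('X * (1 - 'X) * q^`(2))).
Proof.
elim/poly_ind: q => [|p c [IH1 IH2]].
  have b0 n : bernp n 0 = 0.
    by rewrite /bernp; under eq_bern do rewrite horner0; rewrite bern_cst.
  split; first by under eq_fun do rewrite b0; exact: pcvg_cst.
  under eq_fun do rewrite b0 subr0 scaler0.
  by rewrite linear0 mulr0 scaler0; exact: pcvg_cst.
split.
  rewrite (_ : p * 'X + c%:P = 'X * p + 0 *: ('X * (1 - 'X) * p^`()) + c%:P); last first.
    by rewrite scale0r addr0 mulrC.
  apply: (@pcvg_near _ (fun n => 'X * bernp n p +
      n%:R^-1 *: ('X * (1 - 'X) * (bernp n p)^`()) + c%:P)).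
    near=> n; rewrite scale0r addr0 [X in bernp n (X + _)]mulrC bernpMXaddC//.
    by near: n; exists 1%N.
  apply: pcvgD; last exact: pcvg_cst.
  apply: pcvgD; first exact: pcvgMX.
  apply: pcvgZ; last by apply: pcvg_XonemX; apply: pcvg_deriv.
  exact: cvg_invn.
(* Since (X p)'' = X p'' + 2 p', the claimed limit obeys the same recursion. *)
rewrite (_ : _ *: _ = 'X * (2^-1 *: ('X * (1 - 'X) * p^`(2))) + 'X * (1 - 'X) * p^`()); last first.
  rewrite !derivnS derivn0 derivMXaddC derivD derivM derivX mulr1 addrCA -mulr2n.
  rewrite mulrDr scalerDr; congr (_ + _).
    by rewrite -scalerAr; congr (_ *: _); ring.
  by rewrite mulrnAr -[X in _ *: X]scaler_nat scalerA mulVf ?pnatr_eq0// scale1r.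
apply: (@pcvg_near _ (fun n => 'X * (n%:R *: (bernp n p - p)) +
      ('X * (1 - 'X) * (bernp n p)^`()))).
  near=> n.
  have n0 : (0 < n)%N by near: n; exists 1%N.
  rewrite bernpMXaddC// opprD addrACA subrr addr0 addrAC [p * 'X]mulrC -mulrBr.
  by rewrite [RHS]scalerDr scalerA divff ?pnatr_eq0 -?lt0n// scale1r scalerAr.
apply: pcvgD; first exact: pcvgMX.
by apply: pcvg_XonemX; apply: pcvg_deriv.
Unshelve. all: by end_near. Qed.

(** Leibniz's rule stops after three terms, as X (1 - X) has derivatives 1 - 2 X, - 2 and 0. *)
Lemma derivn_XonemXM s q : ('X * (1 - 'X) * q^`(2))^`(s) =
  'X * (1 - 'X) * q^`(s.+2) + (1 - 'X *+ 2) * q^`(s.+1) *+ s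
  - q^`(s) *+ (s * s.-1).
Proof.
elim: s => [|s IH]; first by rewrite !mulr0n subr0 addr0.
have d1 : (1 - 'X : {poly R})^`() = -1 by rewrite derivB derivX (derivC 1) sub0r.
have d2 : (1 - 'X *+ 2 : {poly R})^`() = - 2%:R.
  by rewrite derivB derivMn derivX (derivC 1) sub0r.
have -> : (s.+1 * s.+1.-1 = s * s.-1 + s + s)%N by case: s {IH} => //= s; lia.
rewrite derivnS IH derivB derivD derivM [in X in X + _]derivM !derivMn derivM d2 d1 derivX.
rewrite -!derivnS !mulrnDr.
by ring.
Qed.

(** Touching conditions concern f^(s) whereas Bernstein polynomials sample f; antiderivatives lead
    from the former to the latter. *)
Lemma poly_antiderivn s p : exists q : {poly R}, q^`(s) = p.
Proof.
have anti r : exists q : {poly R}, q^`() = r.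
  (* At i = 0 the division by zero makes the constant coefficient 0; its value does not affect the
     derivative. *)
  exists (\poly_(i < (size r).+1) (r`_i.-1 / i%:R)); apply/polyP => i.
  rewrite coef_deriv coef_poly ltnS; case: ltnP => [ir|ri].
    by rewrite -[LHS]mulr_natr mulfVK ?pnatr_eq0.
  by rewrite mul0rn [RHS]nth_default.
elim: s p => [|s IH] p; first by exists p.
have [r <-] := anti p; have [q <-] := IH r.
by exists q; rewrite derivnS.
Qed.

End bernstein_polynomials.

(** * Exponential decay of the rounding error at interior points *)

Section rounding_error.
Context {R : realType}.
Implicit Types (x r : R).

Lemma cvg0_le_bound (u v : R^nat) (a : R) :
  (\forall n \near \oo, `|u n| <= v n * a) -> v @ \oo --> (0 : R) -> u @ \oo --> (0 : R).
Proof.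
move=> uv v0; apply/norm_cvg0P.
apply: (@squeeze_cvgr _ _ _ _ (fun=> 0) (fun n => v n * a)); last 2 first.
  exact: cvg_cst.
  by rewrite -(mul0r a); apply: cvgM => //; exact: cvg_cst.
by apply: filterS uv => n ->; rewrite normr_ge0.
Qed.

(** Each of the n terms of (1 - x^n) / (1 - x) = 1 + x + ... + x^(n - 1) is at least x^n. *)
Lemma natM_exprn_le x n : 0 <= x <= 1 -> (1 - x) * (n%:R * x ^+ n) <= 1 - x ^+ n.
Proof.
move=> /andP[x0 x1]; elim: n => [|n IH]; first by rewrite mul0r mulr0 expr0 subrr.
have xn0 : 0 <= x ^+ n.+1 by rewrite exprn_ge0.
have xn1 : x ^+ n.+1 <= 1 by rewrite exprn_ile1.
move: IH xn0 xn1; rewrite exprS -natr1; set y := x ^+ n; set N := n%:R.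
by move=> IH xn0 xn1; have := ler_wpM2l x0 IH; nra.
Qed.

(** With t = (1 + r) / 2 < 1 one has r <= t^2. One factor t^n absorbs a power of n, since n t^n <= 1
    / (1 - t), and the other is left for the induction on p. *)
Lemma cvg_natX_exprn p r : 0 <= r < 1 -> n%:R ^+ p * r ^+ n @[n --> \oo] --> (0 : R).
Proof.
elim: p r => [|p IH] r /andP[r0 r1].
  under eq_fun do rewrite expr0 mul1r.
  by apply: cvg_expr; rewrite ger0_norm.
pose t := (1 + r) / 2.
have t0 : 0 <= t by rewrite /t; lra.
have t1 : t < 1 by rewrite /t; lra.
have rt : r <= t * t by rewrite /t; nra.
have t1' : 0 < 1 - t by rewrite subr_gt0.
have := IH t (introT andP (conj t0 t1)).
apply: (@cvg0_le_bound _ _ (1 - t)^-1).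
apply: nearW => n; rewrite ger0_norm ?mulr_ge0 ?exprn_ge0//=.
apply: (@le_trans _ _ ((n%:R ^+ p * t ^+ n) * (n%:R * t ^+ n))).
  rewrite exprSr -!mulrA ler_wpM2l ?exprn_ge0// [leRHS]mulrCA ler_wpM2l//.
  by rewrite -exprMn; apply: lerXn2r => //; exact: mulr_ge0.
rewrite ler_wpM2l ?mulr_ge0 ?exprn_ge0//.
rewrite -(ler_pM2l t1') divff ?gt_eqF//.
rewrite (le_trans (natM_exprn_le _ _)) ?t0 ?(ltW t1)//.
by rewrite gerBl exprn_ge0.
Qed.

(** Each differentiation yields two products of total degree one less, with weights k and m of sum k
    + m. *)
Lemma normr_derivn_XexpM_le j k m x r : 0 <= x <= r -> 0 <= 1 - x <= r ->
  `|('X^k * (1 - 'X) ^+ m : {poly R})^`(j).[x]| <= (k + m)%:R ^+ j * r ^+ (k + m - j).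
Proof.
move=> /andP[x0 xr] /andP[x0' xr']; have r0 : 0 <= r by exact: le_trans xr.
elim: j k m => [|j IH] k m.
  rewrite derivn0 !hornerE /= subn0 ?expr0 ?mul1r ger0_norm ?mulr_ge0 ?exprn_ge0//.
  by rewrite exprD ler_pM ?exprn_ge0//; apply: lerXn2r.
have {}IH k' m' : (k' + m' = (k + m).-1)%N ->
    `|('X^k' * (1 - 'X) ^+ m' : {poly R})^`(j).[x]| <=
    (k + m)%:R ^+ j * r ^+ (k + m - j.+1).
  move=> e; rewrite (le_trans (IH _ _))// e -[(k + m).-1]subn1 -subnDA add1n.
  by rewrite ler_wpM2r ?exprn_ge0//; apply: lerXn2r; rewrite ?nnegrE ?ler0n ?ler_nat ?leq_subr.
rewrite derivSn deriv_XexpM derivnB !derivnMn hornerD hornerN !hornerMn.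
rewrite (le_trans (ler_normB _ _))// !normrMn exprS -mulrA [X in X * (_ * _)]natrD mulrDl.
apply: lerD; rewrite mulr_natl.
  case: k IH => [|k] IH; first by rewrite !mulr0n.
  by rewrite lerMn2r /= IH.
case: m IH => [|m] IH; first by rewrite !mulr0n.
by rewrite lerMn2r/= IH// addnS.
Qed.

(* There are no binomial coefficients: the terms are O(n^s max(x, 1 - x)^(n - s)). *)
Lemma cvg_rounding_error s x (e : nat -> nat -> R) : 0 < x < 1 ->
  (forall n k, `|e n k| <= 1) ->
  n%:R * (\sum_(k < n.+1) e n k *: ('X^k * (1 - 'X) ^+ (n - k)))^`(s).[x]
    @[n --> \oo] --> (0 : R).
Proof.
move=> /andP[x0 x1] e1; pose r := Num.max x (1 - x).
have xr : 0 <= x <= r by rewrite ltW//= le_max lexx.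
have xr' : 0 <= 1 - x <= r by rewrite subr_ge0 ltW//= le_max lexx orbT.
have r0 : 0 < r by rewrite lt_max x0.
have r1 : r < 1 by rewrite gt_max x1 ltrBlDr ltrDl.
(* The exponent s + 2 collects n^s from the derivatives, one n from the number of terms and one from
   the factor in front. *)
have := @cvg_natX_exprn s.+2 r; rewrite ltW// => /(_ r1).
apply: (@cvg0_le_bound _ _ (2 / r ^+ s)).
near=> n; rewrite normrM ger0_norm//.
have n0 : (0 < n)%N by near: n; exists 1%N.
have sn : (s <= n)%N by near: n; exists s.
apply: (@le_trans _ _ (n%:R * \sum_(k < n.+1) (n%:R ^+ s * r ^+ (n - s)))).
  rewrite ler_wpM2l// linear_sum /= horner_sum (le_trans (ler_norm_sum _ _ _))//.
  apply: ler_sum => k _; rewrite derivnZ hornerZ normrM -[leRHS]mul1r ler_pM//.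
  rewrite (le_trans (normr_derivn_XexpM_le _ _ _ xr xr'))//.
  by rewrite subnKC// -ltnS.
rewrite sumr_const card_ord.
have -> : r ^+ (n - s) = r ^+ n / r ^+ s.
  by rewrite -[in RHS](subnK sn) exprD mulfK// expf_neq0// gt_eqF.
have P0 : 0 <= n%:R ^+ s * (r ^+ n / r ^+ s) by rewrite mulr_ge0 ?divr_ge0 ?exprn_ge0// ltW.
have n1 : n.+1%:R <= 2 * n%:R :> R by rewrite -natrM ler_nat; lia.
apply: (@le_trans _ _ (n%:R ^+ s * (r ^+ n / r ^+ s) * (n%:R * (2 * n%:R)))).
  by rewrite -[X in _ * X <= _]mulr_natr mulrCA ler_wpM2l// ler_wpM2l.
by rewrite !exprS le_eqVlt; apply/orP; left; apply/eqP; ring.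
Unshelve. all: by end_near. Qed.
End rounding_error.

(** * Viscosity inequality *)

Section differences.
Context {R : realType}.
Implicit Types (F G : R -> R) (h x : R) (s : nat).

Definition stepdiff h F x : R := F (x + h) - F x.

Lemma continuous_iter_stepdiff s h F : continuous F -> continuous (iter s (stepdiff h) F).
Proof.
move=> cF; elim: s => [//|s]; rewrite iterS; move: (iter s _ F) => G cG x.
apply: cvgB; last exact: cG.
apply: (@cvg_comp _ _ _ (fun x => x + h) G _ (nbhs (x + h))); last exact: cG.
by apply: cvgD; [exact: cvg_id|exact: cvg_cst].
Qed.

Lemma is_derive_iter_stepdiff s h F G : 0 <= h ->
  (forall x, 0 < x < 1 -> is_derive x 1 F (G x)) ->
  forall x, 0 < x -> x + s%:R * h < 1 ->
    is_derive x 1 (iter s (stepdiff h) F) (iter s (stepdiff h) G x).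
Proof.
move=> h0 FG; elim: s => [|s IH] x x0 xs.
  by apply: FG; rewrite x0; move: xs; rewrite mul0r addr0.
move: xs; rewrite -natr1 mulrDl mul1r => xs; rewrite !iterS.
apply: is_deriveB.
  rewrite -[iter _ _ _ _]mulr1; apply: is_derive1_comp; first by apply: IH; lra.
  by rewrite -[X in is_derive _ _ _ X]addr0; exact: is_deriveD.
by apply: IH; lra.
Qed.

(** [F k] stands for the k-th derivative of [F 0]. Continuity is asked on the whole line but
    derivatives only inside (0,1), so that extensions by constants beyond 0 and 1 qualify. *)
Definition derivation_chain s (F : nat -> R -> R) :=
  (forall k, (k <= s)%N -> continuous (F k)) /\
  (forall k, (k < s)%N -> forall x, 0 < x < 1 -> is_derive x 1 (F k) (F k.+1 x)).

(** The mean value theorem turns one difference into h times a derivative; the induction continues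
    with the shifted chain [F \o S]. *)
Lemma iter_stepdiff_ge0 s (F : nat -> R -> R) h x : derivation_chain s F ->
  (forall y, 0 <= y <= 1 -> 0 <= F s y) ->
  0 <= h -> 0 <= x -> x + s%:R * h <= 1 -> 0 <= iter s (stepdiff h) (F 0) x.
Proof.
elim: s F x => [|s IH] F x [cF dF] Fs h0 x0 xs.
  by apply: Fs; rewrite x0; move: xs; rewrite mul0r addr0.
rewrite /= /stepdiff subr_ge0 -subr_ge0.
move: xs; rewrite -natr1 mulrDl mul1r => xs.
have [|y|y|c /[!in_itv]/= /andP[xc cx] ->] :=
    @MVT_segment R (iter s (stepdiff h) (F 0)) (iter s (stepdiff h) (F 1)) x (x + h).
- by rewrite lerDl.
- rewrite in_itv /= => /andP[xy yx].
  by apply: is_derive_iter_stepdiff => //; [exact: dF|lra|lra].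
- by apply: continuous_subspaceT; apply: continuous_iter_stepdiff; exact: cF.
- rewrite mulr_ge0 ?addrK//; last by lra.
  by apply: (IH (F \o S)) => //; [split=> k ks; [exact: cF|exact: dF]|lra|lra].
Qed.

Lemma iter_fdiff_sample s n (F : R -> R) k :
  iter s fdiff (fun k => F (k%:R / n%:R)) k = iter s (stepdiff n%:R^-1) F (k%:R / n%:R).
Proof.
elim: s k => [//|s IH] k /=; rewrite /fdiff /stepdiff !IH.
by rewrite -natr1 mulrDl mul1r.
Qed.

Lemma bern_derivn_sample_ge0 s n (F : nat -> R -> R) x : derivation_chain s F ->
  (forall y, 0 <= y <= 1 -> 0 <= F s y) -> (s <= n)%N -> (0 < n)%N -> 0 <= x <= 1 ->
  0 <= (bern n (fun k => F 0 (k%:R / n%:R)))^`(s).[x].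
Proof.
move=> cF Fs sn n0 x01; apply: bern_derivn_ge0 => // k kn.
rewrite iter_fdiff_sample; apply: iter_stepdiff_ge0 => //.
by rewrite -mulrDl -natrD ler_pdivrMr ?ltr0n// mul1r ler_nat.
Qed.

End differences.

(** * Touching polynomials and the passage to the limit *)

Section touching.
Context {R : realType}.
Implicit Types (x y : R) (s n : nat) (p q : {poly R}).

Lemma derivation_chain_hornerB s (F : nat -> R -> R) q : derivation_chain s F ->
  derivation_chain s (fun k y => q^`(k).[y] - F k y).
Proof.
move=> [cF dF]; split => k ks => [|x x01].
  by move=> x; apply: cvgB; [exact: continuous_horner|exact: cF].
by apply: is_deriveB; exact: dF.
Qed.

Section touching_polynomial.
Variables (x c0 c1 c2 L : R).
Let Y : {poly R} := 'X - x%:P.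
(** The quartic term affects neither the value nor the first two derivatives at x, while a large L
    makes the polynomial dominate away from x. *)
Definition touching_poly : {poly R} := c0%:P + c1 *: Y + c2 *: Y ^+ 2 + L *: Y ^+ 4.

Lemma touching_polyE y : touching_poly.[y] =
  c0 + c1 * (y - x) + c2 * (y - x) ^+ 2 + L * (y - x) ^+ 4.
Proof. by rewrite /touching_poly /Y !hornerE. Qed.

Let dY : Y^`() = 1. Proof. by rewrite derivB derivX derivC subr0. Qed.

Let deriv_touching_poly :
  touching_poly^`() = c1%:P + (c2 * 2) *: Y + (L * 4) *: Y ^+ 3.
Proof.
rewrite /touching_poly !derivD !derivZ derivC add0r dY !deriv_exp dY /=.
by rewrite !mul1r alg_polyC expr1 -[Y *+ 2]scaler_nat -[Y ^+ 3 *+ 4]scaler_nat !scalerA.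
Qed.

Lemma touching_poly_deriv1 : touching_poly^`().[x] = c1.
Proof. by rewrite deriv_touching_poly /Y !hornerE /= subrr; ring. Qed.

Lemma touching_poly_deriv2 : touching_poly^`(2).[x] = 2 * c2.
Proof.
rewrite derivnS derivn1 deriv_touching_poly !derivD !derivZ derivC add0r dY deriv_exp dY.
by rewrite /Y !hornerE /= subrr; ring.
Qed.
End touching_polynomial.

(* A polynomial q with q^(s) = touching_poly dominates F s on all of [0,1], so that
   (B_n F)^(s) <= (B_n q)^(s), and Voronovskaya's theorem applies to q. *)
Lemma touch_above s (F : nat -> R -> R) (P : nat -> {poly R}) (C G x a b c1 c2 : R) :
  derivation_chain s F -> (forall y, 0 <= y <= 1 -> `|F s y| <= G) ->
  0 < x < 1 -> a < x < b ->
  (\forall n \near \oo, F s x - C / n%:R <= (P n)^`(s).[x]) ->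
  n%:R * (P n - bern n (fun k => F 0 (k%:R / n%:R)))^`(s).[x] @[n --> \oo] --> (0 : R) ->
  (forall y, 0 <= y <= 1 -> a <= y <= b ->
     F s y <= F s x + c1 * (y - x) + c2 * (y - x) ^+ 2) ->
  - (2 * C) <= 2 * c2 * (x * (1 - x)) + s%:R * (1 - 2 * x) * c1
             - (s * s.-1)%:R * F s x.
Proof.
move=> cF FG /andP[x0 x1] /andP[ax xb] PC Perr touch.
pose e := Num.min (x - a) (b - x).
have e0 : 0 < e by rewrite lt_min !subr_gt0 ax.
(* Outside [a, b] one has |y - x| >= e, so L (y - x)^4 outweighs the oscillation 2 G of [F s] and
   the linear and quadratic terms. *)
pose L := (2 * G + `|c1| + `|c2|) / e ^+ 4.
have [q qs] := poly_antiderivn s (touching_poly x (F s x) c1 c2 L).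
have x01 : 0 <= x <= 1 by rewrite !ltW.
have G0 : 0 <= G by apply: le_trans (FG x x01); exact: normr_ge0.
have L0 : 0 <= L by rewrite divr_ge0 ?exprn_ge0 ?(ltW e0)// !addr_ge0// mulr_ge0.
have Fq y : 0 <= y <= 1 -> 0 <= q^`(s).[y] - F s y.
  move=> y01; rewrite subr_ge0 qs touching_polyE.
  have [/andP[ay yb]|/nandP ayb] := boolP (a <= y <= b).
    rewrite (le_trans (touch _ y01 _)) ?ay// lerDl mulr_ge0//.
    by rewrite exprn_even_ge0.
  have ey : e <= `|y - x|.
    rewrite ge_min; case: ayb; rewrite -ltNge => h; apply/orP.
      by left; rewrite ltr0_norm ?subr_lt0; lra.
    by right; rewrite gtr0_norm ?subr_gt0; lra.
  have yx1 : `|y - x| <= 1 by rewrite ler_norml; move: y01 => /andP[]; lra.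
  have h4 : 2 * G + `|c1| + `|c2| <= L * (y - x) ^+ 4.
    rewrite /L -mulrAC ler_pdivlMr ?exprn_gt0// ler_wpM2l//.
      by rewrite !addr_ge0// mulr_ge0.
    rewrite -[(y - x) ^+ 4]ger0_norm ?exprn_even_ge0// normrX.
    by apply: lerXn2r; rewrite // ?nnegrE ?ltW.
  have h1 : - `|c1| <= c1 * (y - x).
    by rewrite lerNl (le_trans (ler_norm _))// normrN normrM ler_piMr.
  have h2 : - `|c2| <= c2 * (y - x) ^+ 2.
    rewrite lerNl (le_trans (ler_norm _))// normrN normrM ler_piMr//.
    by rewrite normrX exprn_ile1.
  have /ler_normlP[_ Fy] := FG _ y01; have /ler_normlP[Fx _] := FG _ x01.
  lra.
have [_ /(_ s) V] := cvg_bernp_voronovskaya x q.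
(* The sequence is n (B_n q - B_n F + P n - q)^(s)(x). It is eventually at least - C, because (B_n q
   - B_n F)^(s) >= 0 by positivity, P n has rate C / n and q^(s)(x) = [F s x]. *)
have /(cvgr_to_ge (b := - C)) : n%:R * (bernp n q - q)^`(s).[x] + n%:R *
    (P n - bern n (fun k => F 0 (k%:R / n%:R)))^`(s).[x] @[n --> \oo] -->
    (2^-1 *: ('X * (1 - 'X) * q^`(2)))^`(s).[x] + 0.
  apply: cvgD => //; move: V; under eq_fun do rewrite derivnZ hornerZ.
  exact.
rewrite addr0 derivnZ hornerZ derivn_XonemXM.
have qs1 : q^`(s.+1) = (touching_poly x (F s x) c1 c2 L)^`() by rewrite derivnS qs.
have qs2 : q^`(s.+2) = (touching_poly x (F s x) c1 c2 L)^`(2).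
  by rewrite !derivnS qs.
rewrite qs2 qs1 qs.
rewrite hornerD hornerN hornerD !hornerMn !hornerM touching_poly_deriv1 touching_poly_deriv2.
rewrite touching_polyE !hornerD !hornerN !hornerMn !hornerX !hornerC subrr.
rewrite -[_ *+ s]mulr_natl -[_ *+ (s * _)]mulr_natl.
move=> lim; suff : - C <= 2^-1 * (2 * c2 * (x * (1 - x)) + s%:R * (1 - 2 * x) * c1
    - (s * s.-1)%:R * F s x) by lra.
apply: le_trans (lim _) _; last by rewrite le_eqVlt; apply/orP; left; apply/eqP; ring.
near=> n.
have n0 : (0 < n)%N by near: n; exists 1%N.
have sn : (s <= n)%N by near: n; exists s.
have n0' : 0 < n%:R :> R by rewrite ltr0n.
have := @bern_derivn_sample_ge0 R s n _ x (derivation_chain_hornerB q cF) Fq sn n0 x01.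
rewrite /= bernB derivnB hornerD hornerN -/(bernp n q) => {}lim.
have PCn : F s x - C / n%:R <= (P n)^`(s).[x] by near: n.
have -> : - C = n%:R * - (C / n%:R) by rewrite mulrN mulrCA divff ?mulr1// gt_eqF.
have qx : q^`(s).[x] = F s x by rewrite qs touching_polyE subrr; ring.
rewrite -[X in _ <= X]mulrDr ler_pM2l// !derivnB !hornerD !hornerN qx.
by lra.
Unshelve. all: by end_near. Qed.

End touching.

(** * Barriers and regularity *)

Section barriers.
Context {R : realType}.
Implicit Types (g : R -> R) (x y u a b c v m K G A B : R).

(* Viscosity form of [x (1 - x) g'' + m (1 - 2 x) g' >= - K]. *)
Definition touch_bound m K g := forall x a b c1 c2, 0 < x < 1 -> a < x < b ->
  (forall y, 0 <= y <= 1 -> a <= y <= b ->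
     g y <= g x + c1 * (y - x) + c2 * (y - x) ^+ 2) ->
  - K <= 2 * c2 * (x * (1 - x)) + m * (1 - 2 * x) * c1.

(** Where g - H has a positive maximum, a vertical translate of H touches g from above, and
    [touch_bound] contradicts the strict inequality assumed for H. *)
Lemma quadratic_barrier m K g a b al be ga : continuous g -> touch_bound m K g ->
  0 <= a -> a <= b -> b <= 1 ->
  let H u := al + be * u + ga * u ^+ 2 in
  g a <= H a -> g b <= H b ->
  (forall u, a < u < b ->
    2 * ga * (u * (1 - u)) + m * (1 - 2 * u) * (be + 2 * ga * u) < - K) ->
  forall u, a <= u <= b -> g u <= H u.
Proof.
move=> cg tb a0 ab b1 H ga_le gb_le Hlt u uab; rewrite leNgt; apply/negP => Hu.
have cH : {within `[a, b], continuous (fun u => g u - H u)}.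
  apply: continuous_subspaceT => z; apply: cvgB; first exact: cg.
  by apply: cvgD; [apply: cvgD; [exact: cvg_cst|apply: cvgMr]|apply: cvgMr; exact: exprn_continuous].
have [c /[!in_itv]/= /andP[ac cb] cmax] := EVT_max ab cH.
have Hc : 0 < g c - H c.
  by rewrite (@lt_le_trans _ _ (g u - H u)) ?subr_gt0// cmax// in_itv.
have ac' : a < c.
  by rewrite lt_neqAle ac andbT; apply/eqP => e; move: Hc; rewrite -e subr_gt0 ltNge ga_le.
have cb' : c < b.
  by rewrite lt_neqAle cb andbT; apply/eqP => e; move: Hc; rewrite e subr_gt0 ltNge gb_le.
(* The coefficients are those of the Taylor expansion of H at c. *)
have := tb c a b (be + 2 * ga * c) ga; rewrite leNgt Hlt ?ac'// => h.
suff : false by []; apply: h => //; first by apply/andP; split; lra.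
move=> y y01 yab; have := cmax y; rewrite in_itv /= => /(_ yab).
by rewrite /H; lra.
Qed.

(* Barrier: the parabola g x + 2 B r (u - x) - B (u - x)^2 on [x, x + r]. *)
Lemma onesided_Lipschitz m K G g v : 1 <= m -> 0 <= K -> 0 < v -> continuous g ->
  (forall y, 0 <= y <= 1 -> `|g y| <= G) -> touch_bound m K g ->
  exists2 A, 0 <= A & forall x u, 0 < x < 1 -> v <= x * (1 - x) ->
    x <= u <= x + v / (4 * m) -> g u - g x <= A * (u - x).
Proof.
move=> m1 K0 v0 cg gG tb; have m0 : 0 < m by lra.
have [r [r0 mr rE]] : exists r : R, [/\ 0 < r, 4 * m * r = v & v / (4 * m) = r].
  exists (v / (4 * m)); split=> //; first by rewrite divr_gt0// mulr_gt0.
  by rewrite mulrC divfK// gt_eqF// mulr_gt0.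
rewrite rE.
have G0 : 0 <= G by apply: le_trans (gG 0 _); rewrite ?lexx ?ler01.
have [B BG BK] : exists2 B : R, 2 * G <= B * r ^+ 2 & K < B * v.
  (* The first summand lifts the barrier above g at x + r, the second gives the strict differential
     inequality. *)
  exists (2 * G / r ^+ 2 + (K + 1) / v).
    rewrite [leRHS]mulrDl divfK ?expf_neq0 ?gt_eqF// lerDl mulr_ge0 ?exprn_ge0 ?(ltW r0)//.
    by rewrite divr_ge0 ?(ltW v0)// addr_ge0.
  rewrite [ltRHS]mulrDl divfK ?gt_eqF//.
  have : 0 <= 2 * G / r ^+ 2 * v.
    by rewrite mulr_ge0 ?(ltW v0)// divr_ge0 ?exprn_ge0 ?(ltW r0)// mulr_ge0.
  by lra.
have B0 : 0 < B by rewrite -(pmulr_lgt0 _ v0); lra.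
exists (2 * B * r) => [|x u /andP[x0 x1] vx /andP[xu ux]].
  by rewrite !mulr_ge0 ?(ltW B0) ?(ltW r0).
have x01 : 0 <= x <= 1 by rewrite !ltW.
have rv : 4 * r <= v by rewrite -mr ler_pM2r ?ler_pMr; lra.
have xr1 : x + r <= 1 by nra.
have := @quadratic_barrier m K g x (x + r) (g x - 2 * B * r * x - B * x ^+ 2)
  (2 * B * r + 2 * B * x) (- B) cg tb.
rewrite (ltW x0) xr1 lerDl (ltW r0) => /(_ isT isT isT) h.
have {h} : g u <= g x - 2 * B * r * x - B * x ^+ 2 +
    (2 * B * r + 2 * B * x) * u + - B * u ^+ 2.
  apply: h; last by rewrite xu.
  - by rewrite le_eqVlt; apply/orP; left; apply/eqP; ring.
  - have xr01 : 0 <= x + r <= 1 by apply/andP; split; lra.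
    have /ler_normlP[_ h3] := gG _ xr01.
    have -> : g x - 2 * B * r * x - B * x ^+ 2 + (2 * B * r + 2 * B * x) * (x + r)
       + - B * (x + r) ^+ 2 = g x + B * r ^+ 2 by ring.
    have /ler_normlP[h4 _] := gG x x01; lra.
  - move=> w /andP[xw wx].
    (* On [0,1], w (1 - w) has slope at most 1 in absolute value, and r <= v / 4. So the
       second-order term is at most - 3 B v / 2 and the first-order term at most B v / 2, with sum
       at most - B v < - K. *)
    have vw : 3 / 4 * v <= w * (1 - w) by nra.
    have hw : `|(1 - 2 * w) * (2 * (r - (w - x)))| <= 2 * r.
      rewrite normrM -[leRHS]mul1r ler_pM// ler_norml; lra.
    have {hw} /ler_normlP[_ hw] := hw.
    have h1 : m * ((1 - 2 * w) * (2 * (r - (w - x)))) <= v / 2.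
      by apply: (@le_trans _ _ (m * (2 * r))); [rewrite ler_pM2l|rewrite -mr; lra].
    have h2 : B * (m * ((1 - 2 * w) * (2 * (r - (w - x))))) <= B * (v / 2).
      by rewrite ler_pM2l.
    have h3 : B * (3 / 4 * v) <= B * (w * (1 - w)) by rewrite ler_pM2l.
    have -> : 2 * - B * (w * (1 - w)) + m * (1 - 2 * w) *
      (2 * B * r + 2 * B * x + 2 * - B * w) = - 2 * (B * (w * (1 - w))) +
      B * (m * ((1 - 2 * w) * (2 * (r - (w - x))))) by ring.
    by lra.
have : 0 <= B * (u - x) ^+ 2 by rewrite mulr_ge0 ?sqr_ge0 ?ltW.
by lra.
Qed.

(** The barrier is the chord plus B (u - a) (b - u). Its second-order term is at most - 2 B v,
    whereas the first-order one is at most m A + B v / 4 because the interval is short. *)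
Lemma chord_upper_bound m K g a b v A B : 0 < m -> 0 <= K -> 0 < v -> continuous g ->
  touch_bound m K g -> 0 <= a -> a < b -> b <= 1 -> b - a <= v / (4 * m) ->
  (forall u, a <= u <= b -> v <= u * (1 - u)) ->
  `|g b - g a| <= A * (b - a) -> K + m * A < B * v ->
  forall u, a <= u <= b ->
  g u - g a - (g b - g a) / (b - a) * (u - a) <= B * ((u - a) * (b - u)).
Proof.
move=> m0 K0 v0 cg tb a0 ab b1 bav vu gA BvK u uab.
have ba0 : 0 < b - a by rewrite subr_gt0.
set S := (g b - g a) / (b - a).
have SA : `|S| <= A by rewrite /S normrM normfV (gtr0_norm ba0) ler_pdivrMr.
have A0 : 0 <= A by apply: le_trans SA.
have mba : m * (b - a) <= v / 4.
  by rewrite mulrC -ler_pdivlMr// -mulrA -invfM.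
have B0 : 0 < B.
  by rewrite -(pmulr_lgt0 _ v0) (le_lt_trans _ BvK)// addr_ge0// mulr_ge0// ltW.
have := @quadratic_barrier m K g a b (g a - S * a - B * a * b) (S + B * (a + b)) (- B)
  cg tb a0 (ltW ab) b1 => /=.
have -> : g a - S * a - B * a * b + (S + B * (a + b)) * a + - B * a ^+ 2 = g a by ring.
have -> : g a - S * a - B * a * b + (S + B * (a + b)) * b + - B * b ^+ 2 = g b.
  by transitivity (g a + S * (b - a)); [ring|rewrite /S divfK ?gt_eqF//; ring].
move=> /(_ (lexx _) (lexx _)) h.
have {h} := h _ u uab; rewrite -lerBlDl => h.
suff Hlt : forall u, a < u < b -> 2 * - B * (u * (1 - u)) +
    m * (1 - 2 * u) * (S + B * (a + b) + 2 * - B * u) < - K.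
  by have := h Hlt; lra.
move=> w /andP[aw wb].
have vw : v <= w * (1 - w) by apply: vu; rewrite !ltW.
have h1 : `|(1 - 2 * w) * (S + B * (a + b - 2 * w))| <= A + B * (b - a).
  rewrite normrM -[leRHS]mul1r ler_pM//; first by rewrite ler_norml; lra.
  rewrite (le_trans (ler_normD _ _))// lerD// normrM gtr0_norm// ler_pM2l//.
  by rewrite ler_norml; lra.
have {h1} /ler_normlP[_ h1] := h1.
have h2 : m * ((1 - 2 * w) * (S + B * (a + b - 2 * w))) <= m * (A + B * (b - a)).
  by rewrite ler_pM2l.
have h3 : B * (m * (b - a)) <= B * (v / 4) by rewrite ler_pM2l.
have h4 : B * v <= B * (w * (1 - w)) by rewrite ler_pM2l.
have -> : 2 * - B * (w * (1 - w)) + m * (1 - 2 * w) * (S + B * (a + b) + 2 * - B * w) =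
  - 2 * (B * (w * (1 - w))) + m * ((1 - 2 * w) * (S + B * (a + b - 2 * w))) by ring.
have h5 : 0 < B * v by rewrite mulr_gt0.
by lra.
Qed.

End barriers.

(** * From chord bounds to a Lipschitz derivative *)

Section slopes.
Context {R : realType}.
Variables (g : R -> R) (p q B : R).

Definition slope x y : R := (g y - g x) / (y - x).

Hypothesis chord_bound : forall a u b, p < a -> a < u -> u < b -> b < q ->
  `|g u - g a - slope a b * (u - a)| <= B * ((u - a) * (b - u)).

Lemma slopeC x y : slope x y = slope y x.
Proof. by rewrite /slope -opprB -[X in _ / X]opprB invrN mulrNN. Qed.

(** In each ordering of the three points, the deviation of the middle one from the outer chord is,
    up to sign, the difference of the two slopes times a positive factor. *)
Lemma slope_dist x y z : p < x < q -> p < y < q -> p < z < q -> y != x -> z != x ->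
  `|slope x y - slope x z| <= B * `|y - z|.
Proof.
wlog yz : y z / y < z => [h px py pz yx zx|].
  have [yz|zy|->] := ltgtP y z; first exact: h.
    by rewrite distrC (distrC y); exact: h.
  by rewrite !subrr normr0 mulr0.
move=> /andP[px xq] /andP[py yq] /andP[pz zq] yx zx.
have zy : z - y != 0 by rewrite subr_eq0 gt_eqF.
have yx0 : y - x != 0 by rewrite subr_eq0.
have zx0 : z - x != 0 by rewrite subr_eq0.
have zy0 : 0 < z - y by rewrite subr_gt0.
rewrite (ltr0_norm (_ : y - z < 0)) ?subr_lt0// opprB.
have [xy|yx'|e] := ltgtP x y; last by rewrite e eqxx in yx.
  have xz := lt_trans xy yz; have y0 : 0 < y - x by rewrite subr_gt0.
  have := chord_bound px xy yz zq.
  have -> : g y - g x - slope x z * (y - x) = (slope x y - slope x z) * (y - x).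
    by rewrite mulrBl divfK// gt_eqF.
  by rewrite normrM (gtr0_norm y0) mulrCA mulrC ler_pM2l.
have y0 : 0 < x - y by rewrite subr_gt0.
have [xz|zx'|e] := ltgtP x z; last by rewrite e eqxx in zx.
  have z0 : 0 < z - x by rewrite subr_gt0.
  have := chord_bound py yx' xz zq.
  have -> : g x - g y - slope y z * (x - y) =
      (slope x y - slope x z) * ((x - y) * (z - x) / (z - y)).
    by rewrite /slope; field; rewrite zy yx0 zx0.
  rewrite normrM [X in _ * X]gtr0_norm ?divr_gt0 ?mulr_gt0//.
  by rewrite [X in X <= _ -> _]mulrA ler_pdivrMr// mulrAC ler_pM2r// mulr_gt0.
have z0 : 0 < x - z by rewrite subr_gt0.
have := chord_bound py yz zx' xq.
have -> : g z - g y - slope y x * (z - y) = (slope x y - slope x z) * (x - z).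
  by rewrite [slope y x]slopeC /slope; field; rewrite yx0 zx0.
by rewrite normrM (gtr0_norm z0) [X in _ <= X -> _]mulrA ler_pM2r.
Qed.

Lemma slopeE x h : slope x (h + x) = h^-1 * (g (h + x) - g x).
Proof. by rewrite /slope addrK mulrC. Qed.

Lemma near_in_shift x : p < x < q ->
  \forall h \near (0 : R)^', p < h + x < q /\ h + x != x.
Proof.
move=> /andP[px xq]; near=> h; split.
  have hm : `|h| < Num.min (x - p) (q - x).
    near: h; apply: dnbhs0_lt; rewrite lt_min !subr_gt0 px//.
  by move: hm; rewrite lt_min !ltr_norml => /andP[/andP[? ?] /andP[? ?]]; lra.
by rewrite -subr_eq0 addrK; near: h; exact: nbhs_dnbhs_neq.
Unshelve. all: by end_near. Qed.

(** By [slope_dist] the difference quotients at x are Lipschitz in the other endpoint, hence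
    Cauchy. *)
Lemma slope_cauchy x : p < x < q -> cvg (slope x (h + x) @[h --> 0^']).
Proof.
move=> px; apply/cauchy_cvgP/cauchyP => e e0.
(* No sign of B is assumed, hence [|B| + 1]. *)
have d0 : 0 < e / (2 * (`|B| + 1)) by rewrite divr_gt0// mulr_gt0// ltr_wpDl.
near (0 : R)^' => k.
exists (slope x (k + x)).
suff : \forall h \near 0^', ball (slope x (k + x)) e (slope x (h + x)) by [].
near=> h.
have [ph hx] : p < h + x < q /\ h + x != x by near: h; exact: near_in_shift.
have [pk kx] : p < k + x < q /\ k + x != x by near: k; exact: near_in_shift.
rewrite /ball /= (le_lt_trans (slope_dist px pk ph kx hx))//.
have : `|k| < e / (2 * (`|B| + 1)) by near: k; exact: dnbhs0_lt.
have : `|h| < e / (2 * (`|B| + 1)) by near: h; exact: dnbhs0_lt.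
rewrite !ltr_pdivlMr ?mulr_gt0 ?ltr_wpDl// => hd kd.
have hk : `|k + x - (h + x)| <= `|k| + `|h|.
  by rewrite opprD addrACA subrr addr0; exact: ler_normB.
have h1 := ler_wpM2l (normr_ge0 B) hk.
have h2 : B * `|k + x - (h + x)| <= `|B| * `|k + x - (h + x)|.
  by rewrite ler_wpM2r// ler_norm.
have h3 := normr_ge0 k; have h4 := normr_ge0 h.
lra.
Unshelve. all: by end_near. Qed.

Lemma chord_bound_derivable x : p < x < q -> derivable g x 1.
Proof.
move=> px; have := slope_cauchy px; rewrite /derivable.
under eq_fun do rewrite slopeE.
by under [in X in _ -> X]eq_fun do rewrite [_%:A]mulr1.
Qed.

(** Limit of [slope_dist] as its third point tends to x. *)
Lemma slope_derive_dist x y : p < x < q -> p < y < q -> y != x ->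
  `|slope x y - g^`()%classic x| <= B * `|y - x|.
Proof.
move=> px py yx; have /cvg_ex[l sl] := slope_cauchy px.
have -> : g^`()%classic x = l.
  apply/cvg_lim => //; move: sl.
  by under eq_fun do rewrite slopeE.
have : `|slope x y - slope x (h + x)| @[h --> 0^'] --> `|slope x y - l|.
  by apply: cvg_norm; apply: cvgB => //; exact: cvg_cst.
move=> hl; apply: (ler_cvg_to hl (g := fun h => B * `|y - (h + x)|)); last first.
  near=> h; have [ph hx] : p < h + x < q /\ h + x != x by near: h; exact: near_in_shift.
  exact: slope_dist.
have hx : h + x @[h --> (0 : R)^'] --> x.
  rewrite -[X in _ --> X]add0r; apply: cvgD; last exact: cvg_cst.
  exact: cvg_within.
by apply: cvgMr; apply: cvg_norm; apply: cvgB => //; exact: cvg_cst.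
Unshelve. all: by end_near. Qed.

(** Both derivatives are within B |x - y| of the slope of the chord from x to y. *)
Lemma derive_dist x y : p < x < q -> p < y < q ->
  `|g^`()%classic x - g^`()%classic y| <= 2 * B * `|x - y|.
Proof.
move=> px py; have [->|xy] := eqVneq x y; first by rewrite !subrr normr0 mulr0.
have h1 := slope_derive_dist px py; rewrite eq_sym in h1.
have h2 := slope_derive_dist py px xy.
rewrite -(subrK (slope x y) (g^`()%classic x)) -addrA (le_trans (ler_normD _ _))//.
rewrite -mulrA mulr_natl mulr2n lerD// 1?distrC; first by rewrite (le_trans (h1 xy))// distrC.
by rewrite distrC slopeC.
Qed.
End slopes.

Lemma nbhs_dist_lt {R : realType} (x e : R) : 0 < e -> \forall y \near x, `|x - y| < e.
Proof. by exists e. Qed.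

(** The segment is cut into pieces of length r / 2, and the bounds on them add up. *)
Lemma locally_Lipschitz_segment {R : realType} (F : R -> R) (a b L r : R) : 0 < r ->
  (forall x y, a <= x -> x <= y -> y <= b -> y - x < r -> `|F x - F y| <= L * (y - x)) ->
  forall x y, a <= x -> x <= y -> y <= b -> `|F x - F y| <= L * (y - x).
Proof.
move=> r0 hF x y ax xy yb.
have r2 : 0 < r / 2 by rewrite divr_gt0.
have [n yn] : exists n, y - x <= n%:R * (r / 2).
  exists (Num.bound ((y - x) / (r / 2))); rewrite -ler_pdivrMr// ltW// archi_boundP//.
  by rewrite divr_ge0 ?subr_ge0// ltW.
elim: n y xy yb yn => [|n IH] y xy yb yn.
  have -> : y = x by lra.
  by rewrite !subrr normr0 mulr0.
have [yxr|ryx] := ltP (y - x) r; first exact: hF.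
rewrite -(subrK (F (y - r / 2)) (F x)) -addrA (le_trans (ler_normD _ _))//.
have h1 : `|F x - F (y - r / 2)| <= L * (y - r / 2 - x).
  by apply: IH; [lra|lra|move: yn; rewrite -natr1 mulrDl mul1r; lra].
have h2 : `|F (y - r / 2) - F y| <= L * (y - (y - r / 2)) by apply: hF; lra.
lra.
Qed.

(** * Regularity from two-sided viscosity bounds *)

Section two_sided.
Context {R : realType}.
Implicit Types (x y u a b h A : R).
Variables (g : R -> R) (m K G : R).
Hypotheses (m1 : 1 <= m) (K0 : 0 <= K) (cg : continuous g).
Hypothesis gG : forall y, 0 <= y <= 1 -> `|g y| <= G.
Hypotheses (tbg : touch_bound m K g) (tbNg : touch_bound m K (fun y => - g y)).

Let m0 : 0 < m. Proof. exact: lt_le_trans m1. Qed.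

Let cNg : continuous (fun y => - g y). Proof. by move=> y; apply: cvgN; exact: cg. Qed.

(** Within this distance of x the weight y (1 - y) stays above v = x (1 - x) / 2, and an interval of
    twice this length has length v / (4 m), the limit in [chord_upper_bound]. *)
Definition radius x : R := x * (1 - x) / (16 * m).

Let radius_gt0 x : 0 < x < 1 -> 0 < radius x.
Proof. by move=> /andP[x0 x1]; rewrite divr_gt0 ?mulr_gt0 ?subr_gt0. Qed.

Let radius_le x : 0 < x < 1 -> radius x <= x * (1 - x) / 16.
Proof.
move=> /andP[x0 x1]; rewrite /radius invfM mulrA ler_piMr ?invf_le1//.
by rewrite divr_ge0 ?mulr_ge0 ?subr_ge0// ltW.
Qed.

(** [chord_upper_bound] for g and - g with v = x (1 - x) / 2; the constant B is such that B v = K +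
    m A + 1. *)
Lemma local_chord_bound x A : 0 < x < 1 ->
  (forall a b, x - radius x < a -> a < b -> b < x + radius x -> `|g b - g a| <= A * (b - a)) ->
  forall a u b, x - radius x < a -> a < u -> u < b -> b < x + radius x ->
  `|g u - g a - slope g a b * (u - a)| <=
    2 * (K + m * A + 1) / (x * (1 - x)) * ((u - a) * (b - u)).
Proof.
move=> x01 gA a u b xa au ub bx; have [x0 x1] := andP x01.
have r0 := radius_gt0 x01; have r1 := radius_le x01.
have w0 : 0 < x * (1 - x) by rewrite mulr_gt0 ?subr_gt0.
pose v := x * (1 - x) / 2; have vE : v = x * (1 - x) / 2 by [].
have rv : 8 * m * radius x = v by rewrite vE /radius; field; rewrite gt_eqF.
have BvK : K + m * A < 2 * (K + m * A + 1) / (x * (1 - x)) * v.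
  have -> : 2 * (K + m * A + 1) / (x * (1 - x)) * v = K + m * A + 1.
    by rewrite vE; field; rewrite ?gt_eqF ?subr_gt0.
  by rewrite ltrDl.
clearbody v; have ab := lt_trans au ub.
have uab : a <= u <= b by rewrite !ltW.
have a0 : 0 <= a by nra.
have b1 : b <= 1 by nra.
have bav : b - a <= v / (4 * m).
  have : (b - a) * (4 * m) <= (2 * radius x) * (4 * m) by rewrite ler_pM2r ?mulr_gt0//; lra.
  by rewrite ler_pdivlMr ?mulr_gt0// -rv; lra.
have vu w : a <= w <= b -> v <= w * (1 - w) by move=> /andP[aw wb]; nra.
have v0 : 0 < v by rewrite vE divr_gt0.
have Aab : `|g b - g a| <= A * (b - a) by exact: gA.
have ANab : `|- g b - - g a| <= A * (b - a) by rewrite -opprD normrN.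
have h1 := chord_upper_bound m0 K0 v0 cg tbg a0 ab b1 bav vu Aab BvK uab.
have h2 := chord_upper_bound m0 K0 v0 cNg tbNg a0 ab b1 bav vu ANab BvK uab.
rewrite ler_norml h1 andbT lerNl; apply: le_trans h2.
have -> : (- g b - - g a) / (b - a) = - slope g a b by rewrite -opprD mulNr.
lra.
Qed.

(** [onesided_Lipschitz] bounds g b - g a from above, and applied to - g from below. The constant
    depends on x. *)
Lemma local_Lipschitz x : 0 < x < 1 -> exists A,
  forall a b, x - radius x < a -> a < b -> b < x + radius x -> `|g b - g a| <= A * (b - a).
Proof.
move=> x01; have [x0 x1] := andP x01.
have r0 := radius_gt0 x01; have r1 := radius_le x01.
have w0 : 0 < x * (1 - x) by rewrite mulr_gt0 ?subr_gt0.
have v0 : 0 < x * (1 - x) / 2 by rewrite divr_gt0.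
have rv : 8 * m * radius x = x * (1 - x) / 2 by rewrite /radius; field; rewrite gt_eqF.
have gNG y : 0 <= y <= 1 -> `|- g y| <= G by rewrite normrN; exact: gG.
have [A A0 hA] := onesided_Lipschitz m1 K0 v0 cg gG tbg.
have [A' A'0 hA'] := onesided_Lipschitz m1 K0 v0 cNg gNG tbNg.
exists (Num.max A A') => a b xa ab bx.
have a01 : 0 < a < 1 by apply/andP; split; nra.
have va : x * (1 - x) / 2 <= a * (1 - a) by nra.
have bav : a <= b <= a + x * (1 - x) / 2 / (4 * m).
  have : (b - a) * (4 * m) <= (2 * radius x) * (4 * m) by rewrite ler_pM2r ?mulr_gt0//; lra.
  by rewrite (ltW ab) -lerBlDl => h; rewrite ler_pdivlMr ?mulr_gt0// -rv; lra.
have ba0 : 0 <= b - a by rewrite subr_ge0 ltW.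
rewrite ler_norml; apply/andP; split.
  rewrite lerNl; apply: (@le_trans _ _ (A' * (b - a))).
    by have := hA' a b a01 va bav; lra.
  by rewrite ler_wpM2r// le_max lexx orbT.
by apply: le_trans (hA a b a01 va bav) _; rewrite ler_wpM2r// le_max lexx.
Qed.

Lemma touch_bound_derivable x : 0 < x < 1 -> derivable g x 1.
Proof.
move=> x01; have [A /(local_chord_bound x01) h] := local_Lipschitz x01.
apply: (chord_bound_derivable h).
by rewrite ltrBlDr ltrDl radius_gt0.
Qed.

Lemma touch_bound_derive_continuous x : 0 < x < 1 -> {for x, continuous g^`()%classic}.
Proof.
move=> x01; have [A /(local_chord_bound x01) h] := local_Lipschitz x01.
have r0 := radius_gt0 x01.
have xx : x - radius x < x < x + radius x by rewrite ltrBlDr ltrDl r0.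
set B := _ / _ in h.
apply/cvgrPdist_le => e e0.
have d0 : 0 < e / (`|2 * B| + 1) by rewrite divr_gt0// ltr_wpDl.
near=> y.
have yx : x - radius x < y < x + radius x.
  have : `|x - y| < radius x by near: y; exact: nbhs_dist_lt.
  by rewrite ltr_norml => /andP[]; lra.
apply: le_trans (derive_dist h xx yx) _.
have : `|x - y| < e / (`|2 * B| + 1) by near: y; exact: nbhs_dist_lt.
rewrite ltr_pdivlMr ?ltr_wpDl// => xye.
apply: (@le_trans _ _ (`|2 * B| * `|x - y|)); first by rewrite ler_wpM2r// ler_norm.
by have := normr_ge0 (x - y); lra.
Unshelve. all: by end_near. Qed.

Section bounded_derivative.
Variable A : R.
Hypothesis gA : forall x, 0 < x < 1 -> `|g^`()%classic x| <= A.

Lemma bounded_derive_Lipschitz x y : 0 <= x <= 1 -> 0 <= y <= 1 ->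
  `|g x - g y| <= A * `|x - y|.
Proof.
wlog xy : x y / x < y => [h x01 y01|/andP[x0 x1] /andP[y0 y1]].
  have [xy|yx|->] := ltgtP x y; first exact: h.
    by rewrite distrC (distrC x); exact: h.
  by rewrite !subrr normr0 mulr0.
have [z|z /[!in_itv]/= /andP[xz zy]] := @MVT R g g^`()%classic x y xy _ (continuous_subspaceT cg).
  rewrite in_itv/= => /andP[xz zy].
  by apply: DeriveDef; [apply: touch_bound_derivable; lra|rewrite derive1E].
rewrite distrC => ->; rewrite normrM (distrC x) ler_wpM2r// gA//; lra.
Qed.

Local Notation beta := (2 * (K + m * A + 1)).

Let A0 : 0 <= A.
Proof. by apply: le_trans (gA (_ : 0 < 2^-1 < 1)); [|lra]. Qed.

Let beta0 : 0 < beta.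
Proof. by rewrite mulr_gt0// ltr_wpDl// addr_ge0// mulr_ge0// ltW. Qed.

(** Since A now bounds g' on all of (0,1), the constant depends on x only through the weight. *)
Lemma global_chord_bound x : 0 < x < 1 ->
  forall a u b, x - radius x < a -> a < u -> u < b -> b < x + radius x ->
  `|g u - g a - slope g a b * (u - a)| <= beta / (x * (1 - x)) * ((u - a) * (b - u)).
Proof.
move=> x01; apply: local_chord_bound => // a b xa ab bx.
have [x0 x1] := andP x01; have r1 := radius_le x01.
rewrite (le_trans (bounded_derive_Lipschitz _ _)) ?gtr0_norm ?subr_gt0//;
  by apply/andP; split; nra.
Qed.

Lemma derive_local_Lipschitz x y : 0 < x < 1 -> `|x - y| < x * (1 - x) / (16 * m) ->
  `|g^`()%classic x - g^`()%classic y| <= 2 * beta / (x * (1 - x)) * `|x - y|.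
Proof.
move=> x01; rewrite -/(radius x) ltr_norml => /andP[yx xy].
have := @derive_dist _ _ _ _ _ (global_chord_bound x01) x y.
by rewrite [2 * (_ / _)]mulrA ltrBlDr ltrDl radius_gt0//; apply => //; apply/andP; split; lra.
Qed.

(** [derive_local_Lipschitz] bounds the difference quotients of g' at x, and the bound passes to
    their limit. *)
Lemma derive2_weighted_bound x : 0 < x < 1 -> derivable g^`()%classic x 1 ->
  `|x * (1 - x) * g^`()%classic^`()%classic x| <= 2 * beta.
Proof.
move=> x01 dg; have [x0 x1] := andP x01; have r0 := radius_gt0 x01.
have w0 : 0 < x * (1 - x) by rewrite mulr_gt0 ?subr_gt0.
rewrite normrM gtr0_norm// mulrC -ler_pdivlMr//.
rewrite derive1E; have /cvg_norm/cvgr_to_le := dg; apply; near=> h.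
rewrite /= normrZ normfV [_%:A]mulr1.
have h0 : 0 < `|h| by rewrite normr_gt0; near: h; exact: nbhs_dnbhs_neq.
have hr : `|h| < radius x by near: h; exact: dnbhs0_lt.
rewrite ler_pdivrMl// mulrC distrC.
have := @derive_local_Lipschitz x (h + x) x01.
by rewrite opprD addrCA subrr addr0 normrN; apply.
Unshelve. all: by end_near. Qed.

(* If h phi(x) exceeds the radius then phi(x) <= 16 m h, and the Lipschitz
   continuity of g is enough. *)
Lemma sym_diff2_le x h : 0 <= x <= 1 -> 0 < h ->
  `|sym_diff2 h g x| <= (2 * beta + 32 * m * A) * h ^+ 2.
Proof.
move=> x01 h0; have [x0 x1] := andP x01.
have hA : 0 <= 32 * m * A * h ^+ 2 by rewrite !mulr_ge0 ?sqr_ge0// ltW.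
have hb : 0 <= 2 * beta * h ^+ 2 by exact: mulr_ge0 (mulr_ge0 _ (ltW beta0)) (sqr_ge0 h).
have C0 : 0 <= (2 * beta + 32 * m * A) * h ^+ 2 by rewrite mulrDl addr_ge0.
rewrite /sym_diff2; case: ifPn => [|_]; last by rewrite normr0.
have w0 : 0 <= x * (1 - x) by rewrite mulr_ge0 ?subr_ge0.
have f0 : 0 <= phi x by exact: sqrtr_ge0.
have f2 : phi x ^+ 2 = x * (1 - x) by rewrite sqr_sqrtr.
set t := h * phi x; have t0 : 0 <= t by rewrite mulr_ge0// ltW.
rewrite !in_itv/= => /andP[xt xt'].
have [tr|rt] := ltP t (radius x).
  have wp : 0 < x * (1 - x).
    by have := le_lt_trans t0 tr; rewrite /radius pmulr_lgt0// invr_gt0 mulr_gt0.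
  have x01' : 0 < x < 1 by apply/andP; split; nra.
  have tp : 0 < t by rewrite mulr_gt0// lt_neqAle f0 andbT eq_sym -sqrf_eq0 f2 gt_eqF.
  (* At the midpoint the deviation from the chord is minus half the second difference, and t^2 = h^2
     x (1 - x) cancels the weight. *)
  have := @global_chord_bound x x01' (x - t) x (x + t).
  rewrite ltrD2l ltrN2 ltrBlDr ltrDl ltrD2l tp tr => /(_ isT isT isT isT).
  have -> : slope g (x - t) (x + t) * (x - (x - t)) = (g (x + t) - g (x - t)) / 2.
    by rewrite /slope; field; lra.
  have -> : beta / (x * (1 - x)) * ((x - (x - t)) * (x + t - x)) = beta * h ^+ 2.
    have -> : (x - (x - t)) * (x + t - x) = h ^+ 2 * (x * (1 - x)).
      by rewrite -f2 /t; ring.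
    by rewrite [h ^+ 2 * _]mulrC mulrA divfK ?gt_eqF.
  rewrite !ler_norml => /andP[h1 h2].
  by apply/andP; split; lra.
have ft : t <= 16 * m * h ^+ 2.
  have : phi x ^+ 2 <= 16 * m * t.
    by rewrite [leRHS]mulrC -ler_pdivrMr ?mulr_gt0// f2.
  have [fe|fp] := eqVneq (phi x) 0.
    by move=> _; rewrite /t fe mulr0 !mulr_ge0 ?sqr_ge0// ltW.
  have {}fp : 0 < phi x by rewrite lt_neqAle eq_sym fp.
  rewrite /t expr2 [16 * m * _]mulrA ler_pM2r// => h1.
  by rewrite expr2 [leRHS]mulrA [leRHS]mulrC ler_pM2l.
have -> : g (x + t) - 2 * g x + g (x - t) = (g (x + t) - g x) - (g x - g (x - t)) by ring.
apply: le_trans (ler_normB _ _) _.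
have := bounded_derive_Lipschitz xt x01; have := bounded_derive_Lipschitz x01 xt'.
have -> : x - (x - t) = t by ring.
have -> : x + t - x = t by ring.
rewrite (ger0_norm t0) => h1 h2.
have h3 : A * t <= A * (16 * m * h ^+ 2) by rewrite ler_wpM2l.
by lra.
Qed.

(** On [a, b] the weight is at least a (1 - b), which makes radius and constant uniform for
    [locally_Lipschitz_segment]. *)
Lemma derive_Lipschitz a b x y : 0 < a -> b < 1 -> a <= x -> x <= y -> y <= b ->
  `|g^`()%classic x - g^`()%classic y| <= 2 * beta / (a * (1 - b)) * (y - x).
Proof.
move=> a0 b1 ax xy yb; have ab : a <= b by lra.
have w0 : 0 < a * (1 - b) by rewrite mulr_gt0 ?subr_gt0.
have r0 : 0 < a * (1 - b) / (16 * m) by rewrite divr_gt0// mulr_gt0.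
apply: (locally_Lipschitz_segment r0 _ ax xy yb) => {ax xy yb}x {}y ax xy yb yxr.
have wx : a * (1 - b) <= x * (1 - x) by rewrite ler_pM ?subr_ge0//; lra.
have x01 : 0 < x < 1 by apply/andP; split; lra.
rewrite (le_trans (derive_local_Lipschitz x01 _))// distrC ger0_norm ?subr_ge0//.
  by rewrite (lt_le_trans yxr)// ler_pM2r// invr_gt0 mulr_gt0.
apply: ler_wpM2r; first by rewrite subr_ge0.
apply: ler_wpM2l; first exact: mulr_ge0 _ (ltW beta0).
by rewrite lef_pV2// posrE (lt_le_trans _ wx).
Qed.
End bounded_derivative.
End two_sided.

(** * Almost everywhere differentiability of Lipschitz functions *)

#[local] Instance ae_lebesgue_filter (R : realType) :
  Filter (nbhs (almost_everywhere (@lebesgue_measure R))) :=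
  ae_filter_ringOfSetsType (@lebesgue_measure R).

(** An alias of F that carries the proofs of monotonicity and continuity, through which F receives
    its Stieltjes measure. *)
Definition continuous_cumulative {R : realType} (F : R -> R)
  & {homo F : x y / x <= y} & continuous F : R -> R := F.

HB.instance Definition _ (R : realType) (F : R -> R) (ndF : {homo F : x y / x <= y})
    (cF : continuous F) :=
  isCumulative.Build R _ R (continuous_cumulative ndF cF) ndF (right_continuousW cF).

Section Lipschitz_differentiation.
Context {R : realType}.
Implicit Types (F : R -> R) (a b x y : R).
Notation mu := (@lebesgue_measure R).

Lemma lebesgue_stieltjes_measure_itv_oc (F : cumulative R R) a b : a <= b ->
  lebesgue_stieltjes_measure F `]a, b]%classic = (F b - F a)%:E.
Proof.
move=> ab; rewrite /lebesgue_stieltjes_measure /measure_extension/=.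
rewrite measurable_mu_extE/=; last exact: is_ocitv.
by rewrite wlength_itv_bnd// EFinB.
Qed.

(* The Stieltjes measures of F and id - F add up to the Lebesgue measure; hence the
   former has a Radon-Nikodym density, which is a.e. the derivative of F. *)
Lemma nondecreasing_contraction_derivable_ae F a b : {homo F : x y / x <= y} ->
  (forall x y, x <= y -> F y - F x <= y - x) ->
  {ae mu, forall x, a < x < b -> derivable F x 1}.
Proof.
move=> ndF F1.
have cdist x y : `|F x - F y| <= `|x - y|.
  have [xy|/ltW yx] := leP x y.
    rewrite distrC (distrC x) !ger0_norm ?subr_ge0//; [exact: F1|exact: ndF].
  by rewrite !ger0_norm ?subr_ge0//; [exact: F1|exact: ndF].
have cF : continuous F.
  move=> x; apply/cvgrPdist_lt => e e0; near=> y.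
  by rewrite (le_lt_trans (cdist x y))//; near: y; exact: nbhs_dist_lt.
have ndG : {homo (fun x => x - F x) : x y / x <= y}.
  by move=> x y /F1; lra.
have cG : continuous (fun x => x - F x).
  by move=> x; apply: cvgB; [exact: cvg_id|exact: cF].
pose mF : {measure set (measurableTypeR R) -> \bar R} :=
  lebesgue_stieltjes_measure (continuous_cumulative ndF cF).
pose mG : {measure set (measurableTypeR R) -> \bar R} :=
  lebesgue_stieltjes_measure (continuous_cumulative ndG cG).
have mFE x y : x <= y -> mF `]x, y]%classic = (F y - F x)%:E.
  exact: lebesgue_stieltjes_measure_itv_oc.
have muE A : measurable A -> mu A = (mF A + mG A)%E.
  move=> mA; rewrite -measure_addE.
  apply: (@lebesgue_stieltjes_measure_unique R idfun) => // _ [[x y] _ <-].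
  rewrite [RHS]measure_addE /=.
  have [xy|/ltW yx] := leP x y; last first.
    by rewrite set_itv_ge ?measure0 ?adde0// bnd_simp -leNgt.
  rewrite !lebesgue_stieltjes_measure_itv_oc// -EFinD.
  congr EFin; suff : y - x = F y - F x + (y - F y - (x - F x)) by [].
  by ring.
have [ab|ba] := ltP a b; last first.
  by apply: aeW => x /andP[ax xb]; have := lt_trans ax xb; rewrite ltNge ba.
have mD : measurable (`]a, b]%classic : set (measurableTypeR R)).
  exact: measurable_itv.
have Doo : (mF `]a, b]%classic < +oo)%E.
  by rewrite mFE ?ltW// ltry.
have dom : mfrestr mD Doo `<< mu.
  apply/null_content_dominatesP => A mA A0.
  apply/eqP; rewrite eq_le measure_ge0 andbT.
  have : (mF A <= mu A)%E by rewrite muE// leeDl// measure_ge0.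
  have -> : mu A = 0%E by exact: A0.
  apply: le_trans; rewrite /mfrestr /mrestr.
  by apply: le_measure; rewrite ?inE//; exact: measurableI.
have [f [f0 ffin intf nuE]] := radon_nikodym_sigma_finite dom.
pose fr x := fine (f x).
have frE : EFin \o fr = f by apply/funext => x /=; rewrite fineK.
have intfr : mu.-integrable setT (EFin \o fr) by rewrite frE.
have lfr : locally_integrable setT fr.
  have := @integrable_locally R fr setT measurableT intfr.
  by rewrite patch_setT.
(* On [a, b], F is F a plus the integral of its density, so Lebesgue's differentiation theorem
   applies. *)
have h := @FTC1 R fr (BRight a) _ lfr.
have FE y : a <= y <= b ->
    F y = \int[mu]_(t in `]a, y]) fr t + F a.
  move=> /andP[ay yb]; transitivity (fine (F y - F a)%:E + F a); first by rewrite /= subrK.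
  congr (fine _ + _); rewrite -/(EFin \o fr) frE -nuE// -(mFE _ _ ay).
  by apply/esym/(congr1 mF)/setIidl; exact: subset_itvl.
have ih y : mu.-integrable [set` Interval (BRight a) (BRight y)] (EFin \o fr).
  by apply: integrableS intfr => //; exact: measurable_itv.
have {h} := h ih.
apply: filterS => x hx /andP[ax xb].
have {hx} [dI _] := hx ax.
apply: (@near_eq_derivable _ _ _ (fun y => \int[mu]_(t in `]a, y]) fr t + F a)).
  near=> y; apply/esym/FE.
  have : y \in `]a, b[ by near: y; apply: near_in_itvoo; rewrite in_itv /= ax.
  by rewrite in_itv/= => /andP[ay yb]; rewrite !ltW.
by apply: derivableD; [exact: dI|exact: derivable_cst].
Unshelve. all: by end_near. Qed.

(** For M >= |L|, F + M x is nondecreasing and 2 M-Lipschitz on [a, b]. Clamping to [a, b] extends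
    it to the line, and division by 2 M makes it a nondecreasing contraction. *)
Lemma Lipschitz_derivable_ae F a b L :
  (forall x y, a <= x -> x <= y -> y <= b -> `|F x - F y| <= L * (y - x)) ->
  {ae mu, forall x, a < x < b -> derivable F x 1}.
Proof.
move=> FL.
have [ab|ba] := ltP a b; last first.
  by apply: aeW => x /andP[ax xb]; have := lt_trans ax xb; rewrite ltNge ba.
pose M := `|L| + 1; have M0 : 0 < M by rewrite ltr_wpDl.
have {}FL x y : a <= x -> x <= y -> y <= b -> `|F x - F y| <= M * (y - x).
  move=> ax xy yb; rewrite (le_trans (FL _ _ ax xy yb))// ler_wpM2r ?subr_ge0//.
  by rewrite (le_trans (ler_norm _))// lerDl.
pose c x : R := Num.max a (Num.min x b).
have cE x : a <= x <= b -> c x = x.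
  by move=> /andP[ax xb]; rewrite /c (min_idPl xb) (max_idPr ax).
have cab x : a <= c x <= b by rewrite /c le_max lexx /= ge_max (ltW ab) ge_min lexx orbT.
have cm x y : x <= y -> c x <= c y <= c x + (y - x).
  have c3 z : [\/ z <= a /\ c z = a, b <= z /\ c z = b | a <= z <= b /\ c z = z].
    have [za|az] := leP z a.
      by constructor 1; split=> //; rewrite /c (max_idPl _)// ge_min za.
    have [bz|zb] := leP b z.
      by constructor 2; split=> //; rewrite /c (min_idPr bz) (max_idPr (ltW ab)).
    by constructor 3; rewrite !ltW//= cE ?ltW.
  by case: (c3 x) => -[+ ->]; case: (c3 y) => -[+ ->]; lra.
pose F1 x := (F (c x) + M * c x) / (2 * M).
have M2 : 0 < 2 * M by rewrite mulr_gt0.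
have : {ae mu, forall x, a < x < b -> derivable F1 x 1}.
  have h x y : x <= y -> - (M * (c y - c x)) <= F (c x) - F (c y) <= M * (c y - c x).
    move=> /cm /andP[xy _]; rewrite -ler_norml; apply: FL => //.
      by have /andP[] := cab x.
    by have /andP[] := cab y.
  apply: nondecreasing_contraction_derivable_ae => x y xy; have /andP[h1 h2] := h _ _ xy.
    by rewrite ler_pM2r ?invr_gt0//; lra.
  have /andP[_ h3] := cm _ _ xy.
  have h4 : M * (c y - c x) <= M * (y - x) by rewrite ler_pM2l//; lra.
  by rewrite -mulrBl ler_pdivrMr//; lra.
apply: filterS => x + /andP[ax xb]; rewrite ax xb => /(_ isT) dF1.
apply: (@near_eq_derivable _ _ _ (fun y => (2 * M) * F1 y - M * y)).
  near=> y.
  have : y \in `]a, b[ by near: y; apply: near_in_itvoo; rewrite in_itv /= ax.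
  rewrite in_itv/= => /andP[ay yb]; rewrite /F1 cE ?ltW//.
  by rewrite mulrC divfK ?gt_eqF// addrK.
apply: (@derivableB _ _ _ (fun y => 2 * M * F1 y) (fun y => M * y)).
  by apply: (@derivableM _ _ (cst (2 * M)) F1); [exact: derivable_cst|exact: dF1].
by apply: (@derivableM _ _ (cst M) id); [exact: derivable_cst|exact: derivable_id].
Unshelve. all: by end_near. Qed.
End Lipschitz_differentiation.

(** * Essential bounds and null sets *)

Section essential_bounds.
Context {R : realType}.
Implicit Types (F h : R -> R) (A D : set R) (a b x M : R).
Notation mu := (@lebesgue_measure R).

Lemma Linfty_ae_bound A F : Linfty A F ->
  exists M, {ae mu, forall x, A x -> `|F x| <= M}.
Proof.
move=> [h /andP[_ /[!inE]/= hoo] Fh].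
(* The L_oo norm is an essential supremum only on a space of positive measure. *)
have muT : (0 < mu setT)%E.
  apply: (@lt_le_trans _ _ (mu (ball (0 : R) 1))).
    by rewrite lebesgue_measure_ball// lte_fin.
  by apply: le_measure; rewrite ?inE//; rewrite ball_itv; exact: measurable_itv.
move: hoo; rewrite /finite_norm unlock /Lnorm muT => hoo.
exists (fine (ess_sup mu (abse \o (EFin \o h)))).
have := ess_sup_ge mu (abse \o (EFin \o h)).
have : (0 <= ess_sup mu (abse \o (EFin \o h)))%E.
  by apply: ess_sup_gee => //; apply: aeW => x /=.
move=> e0; apply: filterS2 Fh => x Fx hx Ax.
rewrite Fx// -lee_fin fineK//.
by rewrite ge0_fin_numE.
Qed.

Lemma bounded_Linfty A F h M : measurable_fun setT h -> (forall x, `|h x| <= M) ->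
  F = h %[ae mu in A] -> Linfty A F.
Proof.
move=> mh hM Fh; exists h => //; apply/andP; split; rewrite inE//=.
rewrite /finite_norm unlock /Lnorm; case: ifPn => // _.
apply: (@le_lt_trans _ _ M%:E); last exact: ltry.
by apply/ess_supP; apply: aeW => x /=; rewrite lee_fin.
Qed.

(** A violation at one point extends by continuity to a ball, which has positive measure. *)
Lemma ae_continuous_bound F a b M : {in `]a, b[, continuous F} ->
  {ae mu, forall x, x \in `]a, b[ -> `|F x| <= M} ->
  forall x, x \in `]a, b[ -> `|F x| <= M.
Proof.
move=> cF [N [mN N0 sN]] x xab; rewrite leNgt; apply/negP => Mx.
have : \forall y \near x, (y \in `]a, b[) && (M < `|F y|).
  near=> y; apply/andP; split; first by near: y; exact: near_in_itvoo.
  by near: y; have /cvg_norm/cvgr_gt := cF _ xab; apply.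
move=> /nbhs_ballP[e /= e0 xe].
have : (mu (ball x e) <= mu N)%E.
  apply: le_measure; rewrite ?inE//; first by rewrite ball_itv; exact: measurable_itv.
  move=> y /xe /andP[yab My]; apply: sN => /= /(_ yab).
  by rewrite leNgt My.
by rewrite N0 lebesgue_measure_ball ?(ltW e0)// lee_fin leNgt mulrn_wgt0.
Unshelve. all: by end_near. Qed.

Lemma ae_itv_open (P : R -> Prop) a b : (forall x, x \in `]a, b[ -> P x) ->
  {ae mu, forall x, `[a, b]%classic x -> P x}.
Proof.
move=> Ph; exists [set a; b]; split.
- exact: measurableU.
- by apply: countable_lebesgue_measure0; exact: finite_set_countable.
move=> x /= nP; apply: contrapT => /not_orP[/eqP xa /eqP xb]; apply: nP.
rewrite in_itv /= => /andP[ax xb']; apply: Ph.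
by rewrite in_itv /= !lt_neqAle ax xb' xb eq_sym xa.
Qed.

End essential_bounds.

(** * Functions on the unit interval *)

Section derivatives_on_unit_interval.
Context {R : realType}.
Implicit Types (F G : R -> R) (p : {poly R}) (x l : R) (k s : nat).

Lemma near_diff_quot01 F x (P : R -> Prop) : diff_quot01 F x P <->
  exists2 e : R, 0 < e & forall y, `|x - y| < e -> y != x -> y \in `[0, 1] ->
    P ((F y - F x) / (y - x)).
Proof.
by split=> -[e /= e0 h]; exists e => // y /= xy yx y01; exact: h.
Qed.

(** Near an interior point the restriction to [0,1] is vacuous. Equality of the filters settles
    existence and value of the derivative at once. *)
Lemma diff_quot01_interior F x : 0 < x < 1 ->
  diff_quot01 F x = h^-1 *: (F (h *: 1 + x) - F x) @[h --> 0^'].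
Proof.
move=> /andP[x0 x1]; apply/seteqP; split => P.
  move=> /near_diff_quot01[e e0 hP].
  suff : \forall h \near (0 : R)^', P (h^-1 *: (F (h *: 1 + x) - F x)) by [].
  near=> h.
  have h0 : h != 0 by near: h; exact: nbhs_dnbhs_neq.
  have he : `|h| < Num.min e (Num.min x (1 - x)).
    by near: h; apply: dnbhs0_lt; rewrite !lt_min e0 x0 subr_gt0.
  move: he; rewrite !lt_min => /and3P[he hx hx1].
  have := hP (h + x).
  rewrite addrK [_%:A]mulr1 mulrC; apply.
  - by rewrite opprD addrCA subrr addr0 normrN.
  - by rewrite -subr_eq0 addrK.
  - by rewrite in_itv/=; move: hx hx1; rewrite !ltr_norml => /andP[? ?] /andP[? ?]; lra.
move=> [e /= e0 h]; apply/near_diff_quot01; exists e => // y xy yx _.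
have := h (y - x); rewrite /= sub0r normrN distrC => /(_ xy).
by rewrite subr_eq0 => /(_ yx); rewrite [_%:A]mulr1 subrK mulrC.
Unshelve. all: by end_near. Qed.

Lemma derivable01_interior F x : 0 < x < 1 -> derivable01 F x <-> derivable F x 1.
Proof. by move=> x01; rewrite /derivable01 diff_quot01_interior. Qed.

Lemma derive01_interior F x : 0 < x < 1 -> derive01 F x = F^`()%classic x.
Proof. by move=> x01; rewrite derive1E /derive01 diff_quot01_interior. Qed.

Lemma near_itv01 x : 0 < x < 1 -> \forall y \near x, 0 < y < 1.
Proof.
move=> x01; have : x \in `]0, 1[ by rewrite in_itv.
by move=> /near_in_itvoo; apply: filterS => y; rewrite in_itv.
Qed.

Lemma derive1_eq_itv01 F G x : (forall y, 0 < y < 1 -> F y = G y) -> 0 < x < 1 ->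
  F^`()%classic x = G^`()%classic x.
Proof.
move=> FG x01; rewrite !derive1E; apply: near_eq_derive.
by apply: filterS (near_itv01 x01) => y; exact: FG.
Qed.

Lemma derive01n_horner F p k x : (forall y, 0 < y < 1 -> F y = p.[y]) -> 0 < x < 1 ->
  derive01n k F x = p^`(k).[x].
Proof.
move=> Fp; elim: k x => [|k IH] x x01; first exact: Fp.
rewrite /derive01n iterS -/(derive01n k F) derive01_interior//.
rewrite (derive1_eq_itv01 IH x01) derivnS.
by rewrite derivE.
Qed.

(** Near x the difference quotient is bounded by |l| + 1, with l its limit, which gives a Lipschitz
    estimate at x. *)
Lemma derivable01_continuous F : (forall x, x \in `[0, 1] -> derivable01 F x) ->
  {within `[0, 1], continuous F}.
Proof.
move=> dF; apply/subspace_continuousP => x /= x01.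
have /cvg_ex[l Fl] := dF x x01.
apply/cvgrPdist_lt => e e0.
move/cvgrPdist_lt : Fl => /(_ 1 ltr01) [d /= d0 hd].
have l0 : 0 < `|l| + 1 by rewrite ltr_wpDl.
have m0 : 0 < Num.min d (e / (`|l| + 1)) by rewrite lt_min d0 divr_gt0.
exists (Num.min d (e / (`|l| + 1))) => // y /=.
rewrite lt_min ltr_pdivlMr// => /andP[xyd xye] y01.
have [->|yx] := eqVneq y x; first by rewrite subrr normr0.
have := hd y xyd yx y01; set q := _ / _ => lq.
have -> : F x - F y = q * (x - y).
  by rewrite -opprB -[x - y]opprB mulrN /q divfK// subr_eq0.
rewrite normrM mulrC (le_lt_trans _ xye)// ler_wpM2l//.
rewrite -(subKr l q) (le_trans (ler_normB _ _))// lerD2l; exact: ltW.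
Qed.

(* Composition with clamp01 extends continuous functions on [0,1] to the line. *)
Definition clamp01 x : R := Num.max 0 (Num.min x 1).

Lemma clamp01_id x : 0 <= x <= 1 -> clamp01 x = x.
Proof. by move=> /andP[x0 x1]; rewrite /clamp01 (min_idPl x1) (max_idPr x0). Qed.

Lemma clamp01_itv x : 0 <= clamp01 x <= 1.
Proof. by rewrite /clamp01 le_max lexx /= ge_max ler01 ge_min lexx orbT. Qed.

Lemma continuous_clamp01 F : {within `[0, 1], continuous F} -> continuous (F \o clamp01).
Proof.
move=> cF x; have c01 := clamp01_itv x.
have cx : {for x, continuous clamp01}.
  by apply: continuous_max; [exact: cvg_cst|apply: continuous_min; [exact: cvg_id|exact: cvg_cst]].
have /subspace_continuousP/(_ (clamp01 x)) := cF; rewrite /= in_itv /= => /(_ c01) h.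
move=> A /h [e /= e0 hA].
have xe : \forall y \near x, ball (clamp01 x) e (clamp01 y).
  exact: (cx _ (nbhsx_ballx (clamp01 x) e e0)).
suff : \forall y \near x, A (F (clamp01 y)) by [].
apply: filterS xe => y xy; apply: hA => //.
by rewrite /= in_itv /= clamp01_itv.
Qed.

Lemma Cs01_derivation_chain s F : Cs01 s F ->
  derivation_chain s (fun k => derive01n k F \o clamp01).
Proof.
move=> [dF cF]; split=> k ks => [|x x01].
  apply: continuous_clamp01; move: ks; rewrite leq_eqVlt => /orP[/eqP ->//|ks].
  by apply: derivable01_continuous; exact: dF.
have x01' : x \in `[0, 1] by have /andP[? ?] := x01; rewrite in_itv/= !ltW.
have /derivable01_interior dkF := dF k ks x x01'.
have e : \forall y \near x, derive01n k F y = (derive01n k F \o clamp01) y.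
  apply: filterS (near_itv01 x01) => y /andP[? ?] /=.
  by rewrite clamp01_id// !ltW.
apply: DeriveDef; first by apply: near_eq_derivable e _; exact: dkF.
rewrite -(near_eq_derive _ e) -derive1E -derive01_interior//=.
by rewrite clamp01_id//; have /andP[? ?] := x01; rewrite !ltW.
Qed.

End derivatives_on_unit_interval.

(** * Viscosity bounds from the approximation rate *)

Section rounded_bernstein.
Context {R : realType}.
Implicit Types (f : R -> R) (rnd : R -> int) (n s : nat) (x : R).

Definition rounded_bern rnd f n : {poly R} :=
  \sum_(k < n.+1) (rnd (f (k%:R / n%:R) * 'C(n, k)%:R))%:~R *: ('X^k * (1 - 'X) ^+ (n - k)).

Lemma rounded_bernE rnd f n x : (rounded_bern rnd f n).[x] = bernstein_rounded rnd n f x.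
Proof.
rewrite horner_sum; apply: eq_bigr => k _.
by rewrite !hornerE.
Qed.

Lemma cvg_rounded_bernB s rnd f x : (forall a, `|(rnd a)%:~R - a| <= 1) -> 0 < x < 1 ->
  n%:R * (rounded_bern rnd f n - bern n (fun k => f (k%:R / n%:R)))^`(s).[x]
    @[n --> \oo] --> (0 : R).
Proof.
move=> r1 x01; pose c n (k : nat) := f (k%:R / n%:R) * 'C(n, k)%:R.
have := cvg_rounding_error s x01 (fun n k => r1 (c n k)).
rewrite (_ : (fun n => _) = (fun n => n%:R *
  (rounded_bern rnd f n - bern n (fun k => f (k%:R / n%:R)))^`(s).[x]))//.
apply/funext => n; congr (_ * _^`(s).[x]).
by rewrite -sumrB; apply: eq_bigr => k _; rewrite scalerBl.
Qed.

Lemma touch_bound_chain s F (P : nat -> {poly R}) (C G : R) : derivation_chain s F ->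
  (forall y, 0 <= y <= 1 -> `|F s y| <= G) ->
  (forall x, 0 < x < 1 -> \forall n \near \oo, `|(P n)^`(s).[x] - F s x| <= C / n%:R) ->
  (forall x, 0 < x < 1 ->
    n%:R * (P n - bern n (fun k => F 0 (k%:R / n%:R)))^`(s).[x] @[n --> \oo] --> (0 : R)) ->
  touch_bound s%:R (2 * C + (s * s.-1)%:R * G) (F s).
Proof.
move=> cF FG FP Perr x a b c1 c2 x01 xab touch.
have FPx : \forall n \near \oo, F s x - C / n%:R <= (P n)^`(s).[x].
  by apply: filterS (FP x x01) => n; rewrite ler_distl => /andP[].
have h := touch_above cF FG x01 xab FPx (Perr x x01) touch.
have : - ((s * s.-1)%:R * G) <= (s * s.-1)%:R * F s x.
  rewrite -mulrN ler_wpM2l// lerNl.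
  have /FG : 0 <= x <= 1 by have /andP[? ?] := x01; rewrite !ltW.
  by rewrite ler_norml lerNl => /andP[].
lra.
Qed.

Lemma derivation_chainN s (F : nat -> R -> R) : derivation_chain s F ->
  derivation_chain s (fun k x => - F k x).
Proof.
move=> [cF dF]; split=> k ks => [x|x x01]; first by apply: cvgN; exact: cF.
by apply: is_deriveN; exact: dF.
Qed.

Lemma approx_rate_touch_bound s rnd f : (forall a, `|(rnd a)%:~R - a| <= 1) ->
  Cs01 s f -> approx_rate s f (bernstein_rounded rnd) ->
  exists K G : R, [/\ 0 <= K,
    forall y, 0 <= y <= 1 -> `|(derive01n s f \o clamp01) y| <= G,
    touch_bound s%:R K (derive01n s f \o clamp01) &
    touch_bound s%:R K (fun y => - (derive01n s f \o clamp01) y)].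
Proof.
move=> r1 fs [C hC]; set g := derive01n s f \o clamp01; have ch := Cs01_derivation_chain fs.
have cg : continuous g by exact: ch.1.
have [c _ gc] := @EVT_max R (fun y => `|g y|) 0 1 ler01
  (continuous_subspaceT (fun y => cvg_norm (cg y))).
have gG y : 0 <= y <= 1 -> `|g y| <= `|g c| by move=> y01; apply: gc; rewrite in_itv.
pose P := rounded_bern rnd f.
have PC x : 0 < x < 1 -> \forall n \near \oo, `|(P n)^`(s).[x] - g x| <= `|C| / n%:R.
  move=> x01; have x01' : 0 <= x <= 1 by have /andP[? ?] := x01; rewrite !ltW.
  apply: filterS hC => n hC.
  have : (`|derive01n s (bernstein_rounded rnd n f) x - derive01n s f x|%:E <= (C / n%:R)%:E)%E.
    by apply: le_trans hC; apply: ereal_sup_ubound; exists x => //; rewrite /= in_itv.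
  rewrite lee_fin (derive01n_horner s (p := P n))//; last first.
    by move=> y _; rewrite rounded_bernE.
  rewrite /g /= clamp01_id// => /le_trans; apply.
  by rewrite ler_wpM2r ?invr_ge0// ler_norm.
have Perr x : 0 < x < 1 -> n%:R * (P n -
    bern n (fun k => (f \o clamp01) (k%:R / n%:R)))^`(s).[x] @[n --> \oo] --> (0 : R).
  move=> x01; apply: cvg_trans (cvg_rounded_bernB s f r1 x01).
  apply: near_eq_cvg; apply: nearW => n; congr (_ * (_ - _)^`(s).[x]).
  apply: eq_bern => k kn; rewrite /= clamp01_id//.
  have [->|n0] := posnP n; first by rewrite invr0 mulr0 lexx ler01.
  by rewrite divr_ge0//= ler_pdivrMr ?ltr0n// mul1r ler_nat.
exists (2 * `|C| + (s * s.-1)%:R * `|g c|), `|g c|; split=> //.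
  exact: (touch_bound_chain ch gG PC Perr).
apply: (touch_bound_chain (P := fun n => - P n) (derivation_chainN ch)) => [y y01|x x01|x x01].
- by rewrite normrN; exact: gG.
- apply: filterS (PC x x01) => n.
  by rewrite derivnN hornerN -opprD normrN.
rewrite -oppr0; apply: cvg_trans (cvgN (Perr x x01)).
apply: near_eq_cvg; apply: nearW => n /=.
rewrite opprfctE -mulrN -hornerN -derivnN opprD; congr (_ * (_ - _)^`(s).[x]).
by rewrite -scaleN1r -bernZ; apply: eq_bern => k _; rewrite mulN1r.
Qed.

End rounded_bernstein.

(** * Absolute continuity, global bounds and measurability *)

Section conclusions.
Context {R : realType}.
Implicit Types (F : R -> R) (A : set R) (a b d x y L M : R).
Notation mu := (@lebesgue_measure R).

Lemma Lipschitz_abs_cont A F L :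
  (forall x y, x <= y -> `[x, y] `<=` A -> `|F y - F x| <= L * (y - x)) -> abs_cont A F.
Proof.
move=> FL e e0; have L0 : 0 < `|L| + 1 by rewrite ltr_wpDl.
exists (e / (`|L| + 1)) => [|n a b abA _]; first by rewrite divr_gt0.
rewrite ltr_pdivlMr// mulrC; apply: le_lt_trans.
rewrite mulr_sumr; apply: ler_sum => i _; have [ab sA] := abA i.
rewrite (le_trans (FL _ _ ab sA))// ler_wpM2r ?subr_ge0//.
by rewrite (le_trans (ler_norm _))// lerDl.
Qed.

(** The compact interval [d / 2, 1 - d' / 2] covers what the two end pieces leave, and continuity
    bounds F there. *)
Lemma bounded_itv01 F d d' M M' : 0 < d <= 1 -> 0 < d' <= 1 ->
  (forall x, 0 < x < 1 -> {for x, continuous F}) ->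
  (forall x, 0 < x < d -> `|F x| <= M) ->
  (forall x, 1 - d' < x < 1 -> `|F x| <= M') ->
  exists2 L, 0 <= L & forall x, 0 < x < 1 -> `|F x| <= L.
Proof.
move=> /andP[d0 d1] /andP[d'0 d'1] cF FM FM'.
have ab : d / 2 <= 1 - d' / 2 by lra.
have cF' : {within `[d / 2, 1 - d' / 2], continuous (fun x => `|F x|)}.
  apply: continuous_in_subspaceT => x; rewrite inE /= in_itv /= => xab.
  by apply: cvg_norm; apply: cF; lra.
have [c _ Fc] := EVT_max ab cF'.
exists (Num.max `|F c| (Num.max M M')) => [|x x01]; first by rewrite le_max normr_ge0.
have [xd|dx] := ltP x d.
  by rewrite !le_max FM ?orbT//; lra.
have [dx'|xd'] := ltP (1 - d') x.
  by rewrite !le_max FM' ?orbT//; lra.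
by rewrite le_max Fc// in_itv /=; lra.
Qed.

(** Countably many intervals exhaust (0,1), and the endpoints form a null set. *)
Lemma ae_itv01 (P : R -> Prop) :
  (forall a b, 0 < a -> b < 1 -> {ae mu, forall x, a < x < b -> P x}) ->
  {ae mu, forall x, `[0, 1]%classic x -> P x}.
Proof.
move=> aeP.
have h1 : {ae mu, forall x, forall n, n.+2%:R^-1 < x < 1 - n.+2%:R^-1 -> P x}.
  by apply: ae_foralln => n; apply: aeP; rewrite ?invr_gt0// ltrBlDr ltrDl invr_gt0.
have h2 := @ae_itv_open R (fun x => 0 < x < 1) 0 1 (fun x => id).
apply: filterS2 h1 h2 => x h1 h2 /h2 /andP[x0 x1].
have m0 : 0 < Num.min x (1 - x) by rewrite lt_min x0 subr_gt0.
near \oo => n.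
have : n.+1%:R^-1 < Num.min x (1 - x).
  by near: n; exact: (near_infty_natSinv_lt (PosNum m0)).
rewrite lt_min => /andP[nx nx1]; apply: (h1 n).
have : n.+2%:R^-1 <= n.+1%:R^-1 :> R by rewrite lef_pV2 ?posrE// ler_nat.
move: nx nx1; move: (n.+1%:R^-1) (n.+2%:R^-1) => u v nx nx1 uv.
by apply/andP; split; lra.
Unshelve. all: by end_near. Qed.

(** The derivative is the pointwise limit on E of difference quotients with step 1 / (n + 1);
    extension of F by 0 outside (0,1) makes these measurable on the line. *)
Lemma measurable_derive1 F (E : set R) : measurable E ->
  E `<=` `]0, 1[ -> (forall x, 0 < x < 1 -> {for x, continuous F}) ->
  (forall x, E x -> derivable F x 1) -> measurable_fun E F^`()%classic.
Proof.
move=> mE E01 cF dF.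
pose F0 := F \_ (`]0, 1[ : set R).
have mF0 : measurable_fun setT F0.
  apply/(measurable_restrictT _ (measurable_itv _)).
  apply: open_continuous_measurable_fun; first exact: interval_open.
  by move=> x; rewrite inE /= in_itv /=; exact: cF.
apply: (@measurable_fun_cvg _ _ _ E (fun n x => n.+1%:R * (F0 (n.+1%:R^-1 + x) - F0 x))).
  move=> n; apply: (@measurable_funS _ _ _ _ setT) => //.
  apply: measurable_funM => //; apply: measurable_funB => //.
  apply: (@measurableT_comp _ _ _ _ _ _ F0) => //.
  by apply: measurable_funD.
move=> x Ex; have := E01 x Ex; rewrite /= in_itv /= => x01.
have FD : h^-1 *: (F (h *: 1 + x) - F x) @[h --> 0^'] --> F^`()%classic x.
  by rewrite derive1E; exact: dF.
have h0 : (n.+1%:R^-1 : R) @[n --> \oo] --> (0 : R)^'.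
  move=> P [e /= e0 eP].
  suff : \forall n \near \oo, P (n.+1%:R^-1) by [].
  near=> n.
  apply: eP; last by rewrite invr_eq0.
  rewrite /= sub0r normrN gtr0_norm ?invr_gt0//.
  by near: n; exact: (near_infty_natSinv_lt (PosNum e0)).
have x1 : 0 < 1 - x by rewrite subr_gt0; have /andP[] := x01.
apply: cvg_trans (cvg_comp _ _ h0 FD).
apply: near_eq_cvg; near=> n.
rewrite /= invrK [_%:A]mulr1 /F0 !patchE.
rewrite ifT ?ifT//; rewrite inE /= in_itv//=.
have : n.+1%:R^-1 < 1 - x by near: n; exact: (near_infty_natSinv_lt (PosNum x1)).
have : 0 < n.+1%:R^-1 :> R by rewrite invr_gt0.
by move: (n.+1%:R^-1) => u u0 ux; have /andP[? ?] := x01; apply/andP; split; lra.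
Unshelve. all: by end_near. Qed.

End conclusions.

Theorem proposition1p6 (R : realType) (s : nat) (hs : (0 < s)%N)
    (rnd : R -> int) (hrnd : nearest_int rnd)
    (f : R -> R) (hf : Cs01 s f)
    (hf0 : f 0 \is a Num.int) (hf1 : f 1 \is a Num.int)
    (hnear0 : exists d : R, [/\ 0 < d, d <= 1,
       abs_cont `[0, d] (derive01n s f) &
       ess_bounded_deriv `[0, d] (derive01n s f)])
    (hnear1 : exists d : R, [/\ 0 < d, d <= 1,
       abs_cont `[1 - d, 1] (derive01n s f) &
       ess_bounded_deriv `[1 - d, 1] (derive01n s f)])
    (hrate : approx_rate s f (@bernstein_floor R) \/
             approx_rate s f (bernstein_rounded rnd)) :
  ((exists C : R, \forall h \near 0^'+,
      (omega2_phi (derive01n s f) h <= (C * h ^+ 2)%:E)%E) /\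
   (exists C : R, \forall h \near 0^'+,
      (omega1 (derive01n s f) h <= (C * h)%:E)%E)) /\
  [/\ abs_cont `[0, 1] (derive01n s f),
      (forall x : R, x \in `]0, 1[ -> derivable01 (derive01n s f) x) /\
        abs_cont_loc01 (derive01n s.+1 f),
      Linfty `[0, 1] (derive01n s.+1 f) &
      derivable01_ae `[0, 1] (derive01n s.+1 f) /\
        Linfty `[0, 1] (fun x => phi x ^+ 2 * derive01n s.+2 f x)].
Proof.
have floor1 (a : R) : `|(Num.floor a)%:~R - a| <= 1.
  have /andP[h1 h2] := floor_itv a; rewrite intrD1 in h2.
  by rewrite ler_norml; apply/andP; split; lra.
(* Both roundings err by at most 1: the nearest integer is no farther away than the floor. *)
have {hrnd hrate} [r r1 hrate] : exists2 r : R -> int,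
    forall a, `|(r a)%:~R - a| <= 1 & approx_rate s f (bernstein_rounded r).
  case: hrate => hrate; first by exists Num.floor.
  exists rnd => // a; rewrite distrC (le_trans (hrnd a (Num.floor a)))// distrC.
  exact: floor1.
have := approx_rate_touch_bound r1 hf hrate.
set g := derive01n s f \o clamp01 => -[K [G [K0 gG tb tbN]]].
have m1 : 1 <= s%:R :> R by rewrite ler1n.
have cg : continuous g := (Cs01_derivation_chain hf).1 s (leqnn s).
have gE x : 0 <= x <= 1 -> derive01n s f x = g x by move=> x01; rewrite /g /= clamp01_id.
have gE' x : 0 < x < 1 -> derive01n s f x = g x.
  by move=> /andP[x0 x1]; apply: gE; rewrite !ltW.
have dg x : 0 < x < 1 -> derivable g x 1 by exact: touch_bound_derivable gG tb tbN x.
have cg' x : 0 < x < 1 -> {for x, continuous g^`()%classic}.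
  exact: touch_bound_derive_continuous gG tb tbN x.
have g'E x : 0 < x < 1 -> derive01n s.+1 f x = g^`()%classic x.
  by move=> x01; rewrite [LHS](derive01_interior _ x01); exact: derive1_eq_itv01.
have g''E x : 0 < x < 1 -> derive01n s.+2 f x = g^`()%classic^`()%classic x.
  by move=> x01; rewrite [LHS](derive01_interior _ x01); exact: derive1_eq_itv01.
(* Continuity of g' inside (0,1) turns the essential bounds near 0 and 1 into pointwise ones. *)
have [A A0 gA] : exists2 A, 0 <= A & forall x, 0 < x < 1 -> `|g^`()%classic x| <= A.
  have [d [d0 d1 _ [_ /Linfty_ae_bound[M dM]]]] := hnear0.
  have [d' [d'0 d'1 _ [_ /Linfty_ae_bound[M' dM']]]] := hnear1.
  have bd a b N (E : set R) : 0 <= a -> b <= 1 -> `]a, b[%classic `<=` E ->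
      {ae @lebesgue_measure R, forall x, E x -> `|derive01 (derive01n s f) x| <= N} ->
      forall x, a < x < b -> `|g^`()%classic x| <= N.
    move=> a0 b1 abE EN x xab; apply: (@ae_continuous_bound R _ a b); last by rewrite in_itv.
      by move=> y; rewrite in_itv /= => /andP[ay yb]; apply: cg'; lra.
    apply: filterS EN => y yN yab; rewrite -g'E; last by move: yab; rewrite in_itv /=; lra.
    by apply: yN; exact: abE.
  apply: (@bounded_itv01 R _ d d' M M') => //; rewrite ?d0 ?d'0//.
    by apply: (bd _ _ _ `[0, d]%classic) => //; exact: subset_itv_oo_cc.
  apply: (bd _ _ _ `[1 - d', 1]%classic) => //; first by lra.
  exact: subset_itv_oo_cc.
have gL x y : 0 <= x <= 1 -> 0 <= y <= 1 -> `|g x - g y| <= A * `|x - y|.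
  exact: (bounded_derive_Lipschitz m1 K0 cg gG tb tbN gA).
have [b1 [b1_0 gdiff2 gL' g''b]] : exists b1 : R, [/\ 0 <= b1,
    forall x h, 0 <= x <= 1 -> 0 < h -> `|sym_diff2 h g x| <= b1 * h ^+ 2,
    forall a b x y, 0 < a -> b < 1 -> a <= x -> x <= y -> y <= b ->
      `|g^`()%classic x - g^`()%classic y| <= b1 / (a * (1 - b)) * (y - x) &
    forall x, 0 < x < 1 -> derivable g^`()%classic x 1 ->
      `|x * (1 - x) * g^`()%classic^`()%classic x| <= b1].
  (* The constant of the two estimates on g'; adding 32 s A covers the second differences as
     well. *)
  pose b0 := 2 * (2 * (K + s%:R * A + 1)).
  have b0_0 : 0 <= b0 by rewrite !mulr_ge0// !addr_ge0// mulr_ge0.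
  have b0_1 : b0 <= b0 + 32 * s%:R * A by rewrite lerDl !mulr_ge0.
  exists (b0 + 32 * s%:R * A); split.
  - exact: le_trans b0_1.
  - exact: (sym_diff2_le m1 K0 cg gG tb tbN gA).
  - move=> a b x y a0 b1 ax xy yb.
    apply: le_trans (derive_Lipschitz m1 K0 cg gG tb tbN gA a0 b1 ax xy yb) _.
    apply: ler_wpM2r; first by rewrite subr_ge0.
    apply: ler_wpM2r => //; rewrite invr_ge0 mulr_ge0//; lra.
  - move=> x x01 dx; apply: le_trans b0_1.
    exact: (derive2_weighted_bound m1 K0 cg gG tb tbN gA x01 dx).
(* g' is Lipschitz on compact subintervals of (0,1), hence differentiable almost everywhere. *)
have aeD : {ae @lebesgue_measure R,
    forall x, `[0, 1]%classic x -> derivable g^`()%classic x 1 /\ 0 < x < 1}.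
  have := @ae_itv_open R (fun x => 0 < x < 1) 0 1 (fun x => id).
  have : {ae @lebesgue_measure R,
      forall x, `[0, 1]%classic x -> derivable g^`()%classic x 1}.
    apply: ae_itv01 => a b a0 b1'; apply: Lipschitz_derivable_ae => x y ax xy yb.
    exact: gL' a0 b1' ax xy yb.
  by apply: filterS2 => x h1 h2 x01; split; [exact: h1|exact: h2].
have dg'E x : 0 < x < 1 -> derivable g^`()%classic x 1 -> derivable01 (derive01n s.+1 f) x.
  move=> x01 dx; apply/(derivable01_interior _ x01); apply: near_eq_derivable dx.
  by apply: filterS (near_itv01 x01) => y /g'E.
split; [split|split].
- exists b1; near=> h.
  have h0 : 0 < h by near: h; exact: nbhs_right_gt.
  apply: ge_ereal_sup => _ [t /= tP <-].
  move: tP; rewrite in_itv /= => /andP[t0 th].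
  apply: ge_ereal_sup => _ [x /= xP <-].
  move: xP; rewrite in_itv /= => x01; rewrite lee_fin.
  have -> : sym_diff2 t (derive01n s f) x = sym_diff2 t g x.
    rewrite /sym_diff2; case: ifP => //; rewrite !in_itv /= => /andP[? ?].
    by rewrite !gE.
  rewrite (le_trans (gdiff2 x t x01 t0))// ler_wpM2l//.
  by apply: lerXn2r => //; rewrite nnegrE ltW.
- exists A; near=> h.
  apply: ge_ereal_sup => _ [[x y] /= [+ + xyh] <-].
  rewrite !in_itv /= => x01 y01; rewrite lee_fin !gE//.
  by rewrite (le_trans (gL _ _ x01 y01))// ler_wpM2l.
- apply: (@Lipschitz_abs_cont R _ _ A) => x y xy sub.
  have x01 : 0 <= x <= 1.
    by have := sub x; rewrite /= !in_itv /= lexx xy => /(_ isT).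
  have y01 : 0 <= y <= 1.
    by have := sub y; rewrite /= !in_itv /= lexx xy => /(_ isT).
  by rewrite !gE// (le_trans (gL _ _ y01 x01))// ger0_norm ?subr_ge0.
- split=> [x|a b a0 ab b1'].
    rewrite in_itv /= => x01; apply/(derivable01_interior _ x01).
    apply: near_eq_derivable (dg x x01).
    by apply: filterS (near_itv01 x01) => y /gE'.
  apply: (@Lipschitz_abs_cont R _ _ (b1 / (a * (1 - b)))) => x y xy sub.
  have /andP[ax xb] : a <= x <= b.
    by have := sub x; rewrite /= !in_itv /= lexx xy => /(_ isT).
  have /andP[ay yb] : a <= y <= b.
    by have := sub y; rewrite /= !in_itv /= lexx xy => /(_ isT).
  have x01 : 0 < x < 1 by apply/andP; split; lra.
  have y01 : 0 < y < 1 by apply/andP; split; lra.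
  rewrite (g'E x x01) (g'E y y01) distrC; exact: gL' a0 b1' ax xy yb.
- apply: (@bounded_Linfty R _ _ (g^`()%classic \_ (`]0, 1[%classic : set R)) A).
  + apply/(measurable_restrictT _ (measurable_itv _)).
    apply: open_continuous_measurable_fun; first exact: interval_open.
    by move=> x; rewrite inE /= in_itv /=; exact: cg'.
  + move=> x; rewrite patchE; case: ifPn => [|_]; last by rewrite normr0.
    by rewrite inE /= in_itv /=; exact: gA.
  + apply: ae_itv_open => x; rewrite in_itv /= => x01.
    rewrite patchE ifT; [exact: g'E|by rewrite inE /= in_itv].
- split; first by apply: filterS aeD => x h /h[dx x01]; exact: dg'E.
  (* Off the measurable null set N the second derivative exists, so x (1 - x) g'', cut off outside
     E, is a bounded measurable representative. *)
  have [N [mN N0 sN]] := aeD.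
  pose E : set R := `]0, 1[%classic `\` N.
  have mE : measurable E by apply: measurableD.
  have E01 : E `<=` `]0, 1[%classic by exact: subDsetl.
  have ED x : E x -> derivable g^`()%classic x 1 /\ 0 < x < 1.
    move=> [x01 Nx]; have : ~ (~` [set x | `[0, 1]%classic x ->
      derivable g^`()%classic x 1 /\ 0 < x < 1]) x by move=> /sN.
    by move=> /contrapT; apply; exact: subset_itv_oo_cc.
  apply: (@bounded_Linfty R _ _ ((fun x => x * (1 - x) * g^`()%classic^`()%classic x) \_ E) b1).
  + apply/(measurable_restrictT _ mE); apply: measurable_funM.
      apply: measurable_funM => //; exact: measurable_funB.
    by apply: measurable_derive1 => // x /ED[].
  + move=> x; rewrite patchE; case: ifPn => [|_]; last by rewrite normr0.
    by rewrite inE => /ED[? ?]; exact: g''b.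
  + exists N; split=> // x; apply: contra_notP => Nx /= x01.
    have [dx x01'] : derivable g^`()%classic x 1 /\ 0 < x < 1.
      by apply: contrapT => ndx; apply: Nx; apply: sN => /(_ x01).
    rewrite patchE ifT; last by rewrite inE; split.
    have /andP[x0 x1] := x01'.
    rewrite /phi sqr_sqrtr; last by rewrite mulr_ge0 ?subr_ge0 ?ltW.
    by congr (_ * _); exact: g''E.
Unshelve. all: by end_near. Qed.
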